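(* Let $H$ be a real Hilbert space, let $\alpha,c>0$, and let $L:D(L)\subset H\to H$ be a linear m-accretive operator. Let $\tilde{\mathcal{B}}$ be the operator on $H\times H$ with domain $D(\tilde{\mathcal{B}})=D(L)\times H$ given by $$\tilde{\mathcal{B}}[\tilde U,V]^T=[\,L\tilde U+\alpha c\,\tilde U-\alpha\sqrt{c}\,V,\;-\alpha\sqrt{c}\,\tilde U+\alpha V\,]^T .$$ Let $F\in C^1([0,\infty),H)$, $\tilde F=\sqrt{c}\,F$, and let $\tilde W_{init}\in H\times H$. Then there exists a unique solution $\tilde W$, with $\tilde W(t)\in D(\tilde{\mathcal{B}})$, of the Cauchy problem $$\tilde W'+\tilde{\mathcal{B}}\tilde W=[\tilde F,0]^T,\qquad \tilde W(0)=\tilde W_{init}.$$ The evolution of $\tilde W$ is governed by the linear contraction semigroup. When $\tilde F=0$, we have the stability $$\frac{d}{dt}\,\|\tilde W\|^2\le 0 .$$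
   Context: A linear operator $L:D(L)\to H$ is accretive if $\langle LU,U\rangle\ge 0$ for all $U\in D(L)$, and m-accretive if in addition $I+L$ maps $D(L)$ onto $H$. Here $\|\cdot\|$ is the natural product norm on $H\times H$, $\|[\tilde U,V]^T\|^2=\|\tilde U\|_H^2+\|V\|_H^2$. The variable $\tilde W=[\tilde U,V]^T=[\sqrt{c}\,U,V]^T$ is the rescaled form of $W=[U,V]^T$, where $U'-\alpha(V-cU)+LU=F$ and $V'+\alpha(V-cU)=0$; the natural norm of $\tilde W$ equals the weighted norm of $W$ given by $\|[U,V]^T\|_c^2=c\|U\|_H^2+\|V\|_H^2$.
   Formalization: For W_init outside D(B~) no solution with W(t) in D(B~) and W(0)=W_init exists; so the pointwise equation and d/dt|W|^2<=0 are asserted for W_init in D(B~), and for every W_init in HxH a unique mild solution given by the semigroup, with |W|^2 nonincreasing when F~=0. *)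

(* Defs.v *)
From Stdlib Require Import Reals.
From Coquelicot Require Import Coquelicot.
Open Scope R_scope.

Definition nonneg_time (t : R) : Prop := 0 <= t.
Definition pos_time (t : R) : Prop := 0 < t.

(* A real Hilbert space is a complete normed module over R whose norm comes
   from an inner product.  [norm] on [H * H] is Coquelicot's product norm
   sqrt (norm U ^ 2 + norm V ^ 2), i.e. the Hilbert norm of the product. *)
Record is_inner_product {H : NormedModule R_AbsRing} (inner : H -> H -> R)
  : Prop := {
  inner_sym : forall x y, inner x y = inner y x;
  inner_plus_l : forall x y z, inner (plus x y) z = inner x z + inner y z;
  inner_scal_l : forall (k : R) x y, inner (scal k x) y = k * inner x y;
  inner_norm : forall x, inner x x = norm x ^ 2
}.

(* [op] is total, but its values outside [dom] carry no meaning and are never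
   used in the predicates below. *)
Record operator (E : NormedModule R_AbsRing) : Type := Operator {
  dom : E -> Prop;
  op :> E -> E
}.
Arguments Operator {E} dom op.
Arguments dom {E} A x : rename.
Arguments op {E} A x : rename.

Record linear_operator {E : NormedModule R_AbsRing} (A : operator E)
  : Prop := {
  dom_zero : dom A zero;
  dom_plus : forall x y, dom A x -> dom A y -> dom A (plus x y);
  dom_scal : forall (k : R) x, dom A x -> dom A (scal k x);
  op_plus : forall x y, dom A x -> dom A y -> A (plus x y) = plus (A x) (A y);
  op_scal : forall (k : R) x, dom A x -> A (scal k x) = scal k (A x)
}.

Definition accretive {H : NormedModule R_AbsRing} (inner : H -> H -> R)
  (A : operator H) : Prop :=
  forall x, dom A x -> 0 <= inner (A x) x.

Definition m_accretive {H : NormedModule R_AbsRing} (inner : H -> H -> R)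
  (A : operator H) : Prop :=
  accretive inner A /\ forall f, exists x, dom A x /\ plus x (A x) = f.

Definition Btilde {H : NormedModule R_AbsRing} (alpha c : R) (L : operator H)
  : operator (prod_NormedModule R_AbsRing H H) :=
  @Operator (prod_NormedModule R_AbsRing H H)
    (fun W => dom L (fst W))
    (fun W => let U := fst W in let V := snd W in
      (minus (plus (L U) (scal (alpha * c) U)) (scal (alpha * sqrt c) V),
       plus (opp (scal (alpha * sqrt c) U)) (scal alpha V))).

Definition source {H : NormedModule R_AbsRing} (c : R) (F : R -> H) (t : R)
  : prod_NormedModule R_AbsRing H H :=
  (scal (sqrt c) (F t), zero).

(* Derivative relative to a set D of times: the two-sided derivative at
   interior points of D, the one-sided one at its end points. *)
Definition is_derive_within {E : NormedModule R_AbsRing} (D : R -> Prop)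
  (f : R -> E) (t : R) (l : E) : Prop :=
  filterdiff f (within D (locally t)) (fun y : R => scal y l).

Definition C1_on {E : NormedModule R_AbsRing} (D : R -> Prop) (f : R -> E)
  : Prop :=
  exists f' : R -> E,
    (forall t, D t -> is_derive_within D f t (f' t)) /\ continuous_on D f'.

Definition solves_on {E : NormedModule R_AbsRing} (D : R -> Prop)
  (A : operator E) (G W : R -> E) : Prop :=
  forall t, D t ->
    dom A (W t) /\
    exists W't, is_derive_within D W t W't /\ plus W't (A (W t)) = G t.

(* Integrated form of W' + A W = G, W 0 = W0, meaningful for every W0. *)
Definition mild_solution {E : NormedModule R_AbsRing}
  (A : operator E) (G : R -> E) (W0 : E) (W : R -> E) : Prop :=
  continuous_on nonneg_time W /\
  forall t, 0 <= t -> exists IW IG,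
    is_RInt W 0 t IW /\ is_RInt G 0 t IG /\
    dom A IW /\ plus (W t) (A IW) = plus W0 IG.

(* Only the values [S t] with 0 <= t matter. *)
Record contraction_semigroup {E : NormedModule R_AbsRing} (S : R -> E -> E)
  : Prop := {
  sg_linear : forall t, 0 <= t -> is_linear (S t);
  sg_zero : forall x, S 0 x = x;
  sg_plus : forall s t x, 0 <= s -> 0 <= t -> S (s + t) x = S s (S t x);
  sg_contraction : forall t x, 0 <= t -> norm (S t x) <= norm x;
  sg_continuous : forall x, continuous_on nonneg_time (fun t => S t x)
}.

(* The infinitesimal generator of S is exactly -A, domains included. *)
Definition generated_by_opp {E : NormedModule R_AbsRing} (S : R -> E -> E)
  (A : operator E) : Prop :=
  forall x y,
    filterlim (fun h : R => scal (/ h) (minus (S h x) x)) (at_right 0)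
      (locally y)
    <-> dom A x /\ y = opp (A x).

(* Main.v *)
Require Import Defs.
From Stdlib Require Import Reals ZArith Lra Lia ClassicalEpsilon.
From Coquelicot Require Import Coquelicot.
From Corelib Require Import ssreflect.
Open Scope R_scope.

(** The product [H * H] is a Hilbert space for [prod_inner], and [Btilde] is
    m-accretive on it ([Btilde_m_accretive]): the coupling terms add
    [alpha * |sqrt c U - V| ^ 2] to [<L U, U>], and elimination of [V] turns the
    range condition into a resolvent equation for [L].  What remains is the
    theory of [W' + A W = G] for a linear m-accretive operator [A] on a Hilbert
    space [E].

    The resolvents [resolvent A l], inverses of [1 + l A], exist for all [l > 0]
    by a contraction argument ([range_all]); they are commuting contractions.
    The domain of [A] is dense ([m_accretive_dense]): the defects
    [f - resolvent A l f] converge as [l] decreases, by monotonicity of their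
    norms, and a resolvent annihilates their limit.

    The semigroup is the limit of the implicit Euler scheme with dyadic steps.
    Halving the step [l] changes one step by at most [l ^ 2 / 4 * |A (A x)|]
    ([resolvent_halving]), so that over a fixed time the approximations of
    steps [2 ^ -k] differ by a summable amount when [x] lies in the domain of
    [A ^ 2], which is dense ([euler_cv]).  The limit is a contraction semigroup
    whose generator extends [-A]; it equals [-A] since [1 + A] is onto
    ([semigroup_generator]).

    For continuous [g], Duhamel's formula [z] satisfies
    [z (t + h) = S h (z t) + h g t + o(h)] uniformly on compact time intervals.
    Hence the difference quotient of the semigroup at the integral of [z] over
    [[0, t]] converges to [z t - x - int g], and the knowledge of the generator
    makes [z] a mild solution ([duhamel_mild]).  If [G] is continuously
    differentiable and [W0] lies in the domain, integrating the mild solution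
    with source [G'] and initial value [G 0 - A W0] gives a classical solution
    ([duhamel_classical]).

    Uniqueness and the decay of the norm rest on one energy estimate,
    [dissipative_norm_nonincr]: the norm of [u] is nonincreasing when
    [<u', u> <= 0].  It applies to the integral of the difference of two mild
    solutions; a solution that is differentiable at positive times only is
    compared with classical solutions starting from nearby points of the
    domain. *)

(** Fixing the structure at the normed module keeps the same expression from
    being elaborated along different canonical paths when the space is complete,
    which the arithmetic tactics would treat as distinct atoms. *)

Notation "x ⊕ y" := (@plus (NormedModule.AbelianMonoid R_AbsRing _) x y)
  (at level 50, left associativity).
Notation "x ⊖ y" := (@minus (NormedModule.AbelianGroup R_AbsRing _) x y)
  (at level 50, left associativity).
Notation "k ⊙ x" := (@scal R_AbsRing (NormedModule.ModuleSpace R_AbsRing _) k x)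
  (at level 40, left associativity).

(** * Inner products *)

Section InnerProduct.
Context {E : NormedModule R_AbsRing} {ip : E -> E -> R}.
Hypothesis Hip : is_inner_product ip.

Lemma ip_scal_l (k : R) (x y : E) : ip (scal k x) y = k * ip x y.
Proof. exact: (inner_scal_l _ Hip). Qed.

Lemma ip_opp_l (x y : E) : ip (opp x) y = - ip x y.
Proof.
rewrite -(scal_opp_one x) ip_scal_l.
change (opp one : R) with (- (1)); ring.
Qed.

Lemma ip_minus_l (x y z : E) : ip (minus x y) z = ip x z - ip y z.
Proof. rewrite /minus (inner_plus_l _ Hip) ip_opp_l; ring. Qed.

Lemma ip_zero_l (y : E) : ip zero y = 0.
Proof. rewrite -(scal_zero_l y) ip_scal_l; change (zero : R) with 0; ring. Qed.

Lemma ip_scal_r (k : R) (x y : E) : ip x (scal k y) = k * ip x y.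
Proof. by rewrite (inner_sym _ Hip) ip_scal_l (inner_sym _ Hip x). Qed.

Lemma ip_minus_r (x y z : E) : ip x (minus y z) = ip x y - ip x z.
Proof. by rewrite (inner_sym _ Hip) ip_minus_l !(inner_sym _ Hip _ x). Qed.

Lemma ip_zero_r (x : E) : ip x zero = 0.
Proof. by rewrite (inner_sym _ Hip) ip_zero_l. Qed.

Lemma inner_ext (x y : E) : (forall z, ip x z = ip y z) -> x = y.
Proof.
move=> H.
have E0 : norm (minus x y) = 0.
  have := inner_norm _ Hip (minus x y).
  rewrite {1}ip_minus_l H => E1.
  have := norm_ge_0 (minus x y); nra.
have := norm_eq_zero _ E0 => E1.
by rewrite -(plus_zero_r x) -(plus_opp_l y) plus_assoc -/(minus x y) E1 plus_zero_l.
Qed.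

Lemma Cauchy_Schwarz (x y : E) : ip x y <= norm x * norm y.
Proof.
have P := inner_norm _ Hip (minus (scal (norm y) x) (scal (norm x) y)).
rewrite !(ip_minus_l, ip_minus_r, ip_scal_l, ip_scal_r) !(inner_norm _ Hip) (inner_sym _ Hip y) in P.
have P2 := pow2_ge_0 (norm (minus (scal (norm y) x) (scal (norm x) y))).
have Nx := norm_ge_0 x; have Ny := norm_ge_0 y.
case: (Req_dec (norm x) 0) => [Ex|Ex].
  rewrite (norm_eq_zero _ Ex) ip_zero_l norm_zero; lra.
case: (Req_dec (norm y) 0) => [Ey|Ey].
  rewrite (norm_eq_zero _ Ey) ip_zero_r norm_zero; lra.
have Hp : 0 < norm x * norm y by apply: Rmult_lt_0_compat; lra.
have Q : 0 <= (norm x * norm y) * (norm x * norm y - ip x y) by nra.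
case: (Rle_dec (ip x y) (norm x * norm y)) => // Hn; nra.
Qed.

End InnerProduct.

(** Two vectors are equal when all their inner products are: a vector identity
    becomes an identity between real numbers. *)
Ltac vec_with Hip :=
  apply (inner_ext Hip); intro;
  rewrite ?(ip_minus_l Hip, inner_plus_l _ Hip, ip_scal_l Hip, ip_opp_l Hip, ip_zero_l Hip);
  first [ring | lra | field; lra].

(** * Limits, continuity and derivatives by epsilon and delta *)

Lemma Rmax_0_lipschitz (x y : R) : Rabs (Rmax 0 y - Rmax 0 x) <= Rabs (y - x).
Proof. rewrite /Rmax; repeat case: Rle_dec; split_Rabs; lra. Qed.

Section Norms.
Context {E : NormedModule R_AbsRing}.

Lemma norm_scal_R (k : R) (x : E) : norm (scal k x) = Rabs k * norm x.
Proof.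
apply: Rle_antisym; first exact: (norm_scal k x).
case: (Req_dec k 0) => [->|Hk].
  rewrite Rabs_R0; have := norm_ge_0 (scal 0 x : E); lra.
have H : norm x <= Rabs (/ k) * norm (scal k x).
  have E1 : x = scal (/ k) (scal k x).
    rewrite scal_assoc; change (mult (/ k) k) with (/ k * k).
    rewrite Rinv_l //; by rewrite (scal_one x).
  rewrite {1}E1; exact: (norm_scal (/ k) (scal k x)).
have Hp := Rabs_pos_lt _ Hk.
rewrite Rabs_inv in H.
have := Rmult_le_compat_l _ _ _ (Rlt_le _ _ Hp) H.
rewrite -Rmult_assoc Rinv_r; lra.
Qed.

Lemma norm_minus_swap (x y : E) : norm (x ⊖ y) = norm (y ⊖ x).
Proof. by rewrite -norm_opp opp_minus. Qed.

Lemma eq_of_norm_minus_le (x y : E) :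
  (forall eps, 0 < eps -> norm (x ⊖ y) <= eps) -> x = y.
Proof.
move=> H.
have H0 : norm (x ⊖ y) = 0.
  apply: Rle_antisym; last exact: norm_ge_0.
  by apply: le_epsilon => eps He; rewrite Rplus_0_l; apply: H.
have := norm_eq_zero _ H0 => E1.
by rewrite -(plus_zero_r x) -(plus_opp_l y) plus_assoc -/(minus x y) E1 plus_zero_l.
Qed.

Lemma norm_triangle_minus (x y z : E) : norm (x ⊖ z) <= norm (x ⊖ y) + norm (y ⊖ z).
Proof. rewrite (minus_trans y x z); exact: norm_triangle. Qed.

Lemma within_locally_iff (D : R -> Prop) (t : R) (P : R -> Prop) :
  within D (locally t) P <->
  exists d, 0 < d /\ forall y, D y -> Rabs (y - t) < d -> P y.
Proof.
split.
- move=> [d Hd]; exists d; split; first exact: cond_pos.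
  by move=> y Dy Hy; apply: Hd.
- move=> [d [Hd H]]; exists (mkposreal d Hd) => y Hy Dy; exact: H.
Qed.

Lemma filterlim_norm_iff {T : Type} {Fl : (T -> Prop) -> Prop} {FF : Filter Fl}
  (f : T -> E) (l : E) :
  filterlim f Fl (locally l) <->
  forall eps, 0 < eps -> Fl (fun x => norm (f x ⊖ l) < eps).
Proof.
rewrite filterlim_locally_ball_norm; split => H.
- move=> eps He; exact: (H (mkposreal eps He)).
- move=> eps; exact: (H eps (cond_pos eps)).
Qed.

Lemma continuous_on_iff (D : R -> Prop) (f : R -> E) :
  continuous_on D f <->
  forall t, D t -> forall eps, 0 < eps ->
    exists d, 0 < d /\ forall y, D y -> Rabs (y - t) < d -> norm (f y ⊖ f t) < eps.
Proof.
split => H t Dt.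
- move=> eps He; apply/within_locally_iff.
  by move: eps He; apply/filterlim_norm_iff; apply: H.
- apply/filterlim_norm_iff => eps He; apply/within_locally_iff; exact: H.
Qed.

Lemma continuous_iff (f : R -> E) (t : R) :
  continuous f t <->
  forall eps, 0 < eps ->
    exists d, 0 < d /\ forall y, Rabs (y - t) < d -> norm (f y ⊖ f t) < eps.
Proof.
rewrite /continuous filterlim_norm_iff; split => H eps He.
- case: (H eps He) => d Hd; exists d; split; first exact: cond_pos.
  by move=> y; apply: Hd.
- case: (H eps He) => d [Hd H1]; exists (mkposreal d Hd) => y; exact: H1.
Qed.

Lemma at_right_iff (f : R -> E) (l : E) :
  filterlim f (at_right 0) (locally l) <->
  forall eps, 0 < eps ->
    exists d, 0 < d /\ forall h, 0 < h < d -> norm (f h ⊖ l) < eps.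
Proof.
rewrite filterlim_norm_iff; split => H eps He.
- case/within_locally_iff: (H eps He) => d [Hd H1]; exists d; split => // h Hh.
  apply: H1; first lra. rewrite Rminus_0_r Rabs_pos_eq; lra.
- case: (H eps He) => d [Hd H1]; apply/within_locally_iff; exists d; split => // h h0.
  rewrite Rminus_0_r Rabs_pos_eq => [h1|]; [apply: H1; lra | lra].
Qed.

Lemma is_derive_within_iff (D : R -> Prop) (f : R -> E) (t : R) (l : E) : D t ->
  is_derive_within D f t l <->
  forall eps, 0 < eps ->
    exists d, 0 < d /\ forall y, D y -> Rabs (y - t) < d ->
      norm (f y ⊖ f t ⊖ (y - t) ⊙ l) <= eps * Rabs (y - t).
Proof.
move=> Dt; split.
- move=> [_ H] eps He; apply/within_locally_iff.
  have L : is_filter_lim (within D (locally t)) t.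
    move=> P [d Hd]; exists d => y Hy _; exact: Hd.
  exact: (H t L (mkposreal eps He)).
- move=> H; split; first exact: is_linear_scal_l.
  move=> x Hx eps.
  have -> : x = t.
    apply: Req_le_aux => d; have Hd := cond_pos d.
    have : locally x (fun y => Rabs (y - x) < d) by exists d.
    move=> /Hx /within_locally_iff [e [He H1]].
    have := H1 t Dt; rewrite Rminus_diag Rabs_R0 => H2.
    rewrite Rabs_minus_sym; apply: Rlt_le; exact: H2.
  apply/within_locally_iff; exact: (H eps (cond_pos eps)).
Qed.

(** Functions given on [0 <= t] are extended by their value at [0], which makes
    integrals and two-sided limits available. *)
Lemma continuous_Rmax_0 (f : R -> E) : continuous_on nonneg_time f ->
  forall t : R, continuous (fun s : R => f (Rmax 0 s)) t.
Proof.
move=> /continuous_on_iff Cf t; apply/continuous_iff => eps He.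
case: (Cf (Rmax 0 t) (Rmax_l _ _) eps He) => d [Hd H].
exists d; split => // y Hy; apply: H; first exact: Rmax_l.
apply: Rle_lt_trans Hy; exact: Rmax_0_lipschitz.
Qed.

End Norms.

(** * The energy estimate *)

Section Energy.
Context {E : NormedModule R_AbsRing} {ip : E -> E -> R}.
Hypothesis Hip : is_inner_product ip.

Lemma is_derive_within_sqnorm (D : R -> Prop) (u : R -> E) (t : R) (l : E) : D t ->
  is_derive_within D u t l ->
  is_derive_within D (fun s => norm (u s) ^ 2) t (2 * ip l (u t)).
Proof.
move=> Dt /(is_derive_within_iff _ _ _ _ Dt) H.
apply/(is_derive_within_iff _ _ _ _ Dt) => eps He.
set a := norm (u t); set b := norm l.
have Ha : 0 <= a by apply: norm_ge_0.
have Hb : 0 <= b by apply: norm_ge_0.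
set eta := Rmin 1 (eps / (4 * (a + 1))).
have Heta : 0 < eta.
  apply: Rmin_glb_lt; first lra; apply: Rdiv_lt_0_compat; lra.
have Heta1 : eta <= 1 by apply: Rmin_l.
have Heta2 : 4 * a * eta <= eps.
  have E1 : eta <= eps / (4 * (a + 1)) by apply: Rmin_r.
  have E2 : eps / (4 * (a + 1)) * (4 * (a + 1)) = eps by field; lra.
  nra.
case: (H eta Heta) => d [Hd Hd1].
set d2 := eps / (2 * (1 + b) ^ 2).
have Hd2 : 0 < d2 by apply: Rdiv_lt_0_compat; nra.
exists (Rmin d d2); split; first by apply: Rmin_glb_lt.
move=> y Dy Hy.
have Hy1 : Rabs (y - t) < d by have := Rmin_l d d2; lra.
have Hy2 : Rabs (y - t) <= d2 by have := Rmin_r d d2; lra.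
have := Hd1 y Dy Hy1 => Hr.
set r := (X in norm X) in Hr.
set k := Rabs (y - t) in Hr Hy2 *.
have Hk : 0 <= k by apply: Rabs_pos.
set v := u y ⊖ u t.
have Hv : norm v <= (1 + b) * k.
  have -> : v = r ⊕ (y - t) ⊙ l by rewrite /v /r; vec_with Hip.
  apply: Rle_trans; first exact: norm_triangle.
  rewrite norm_scal_R -/k -/b; nra.
change (Rabs (norm (u y) ^ 2 - norm (u t) ^ 2 - (y - t) * (2 * ip l (u t))) <= eps * k).
have -> : norm (u y) ^ 2 - norm (u t) ^ 2 - (y - t) * (2 * ip l (u t))
   = 2 * ip r (u t) + norm v ^ 2.
  rewrite -!(inner_norm _ Hip) /r /v
    !(ip_minus_l Hip, ip_minus_r Hip, ip_scal_l Hip) (inner_sym _ Hip (u y) (u t)); ring.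
have C1 := Cauchy_Schwarz Hip r (u t).
have C2 := Cauchy_Schwarz Hip (opp r) (u t).
rewrite (ip_opp_l Hip) norm_opp in C2.
have Nr := norm_ge_0 r; have Nv := norm_ge_0 v.
rewrite -/a in C1 C2.
have B1 : norm r * a <= eta * k * a by apply: Rmult_le_compat_r.
have B2 : norm v ^ 2 <= (1 + b) ^ 2 * k * d2.
  apply: (Rle_trans _ (((1 + b) * k) ^ 2)); first by apply: pow_incr.
  have : (1 + b) ^ 2 * k * k <= (1 + b) ^ 2 * k * d2.
    apply: Rmult_le_compat_l => //; nra.
  lra.
have B3 : (1 + b) ^ 2 * k * d2 = eps / 2 * k by rewrite /d2; field; lra.
have B4 : 0 <= norm v ^ 2 by apply: pow2_ge_0.
apply: Rabs_le; nra.
Qed.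

(** The energy estimate: on open time intervals the mean value theorem makes
    the squared norm nonincreasing; continuity extends this to the origin,
    where no derivative is assumed. *)
Lemma dissipative_norm_nonincr (u : R -> E) :
  continuous_on nonneg_time u ->
  (forall t, 0 < t -> exists l, is_derive_within pos_time u t l /\ ip l (u t) <= 0) ->
  forall s t, 0 <= s -> s <= t -> norm (u t) <= norm (u s).
Proof.
move=> Cu Hu s t Hs Hst.
set phi := fun x => norm (u (Rmax 0 x)) ^ 2.
have Cphi x : continuous phi x.
  have H1 : continuous (fun x => norm (u (Rmax 0 x))) x.
    apply: continuous_comp; last exact: filterlim_norm.
    exact: continuous_Rmax_0.
  rewrite /phi /=; apply: (continuous_mult (K := R_AbsRing)) => //.
  apply: (continuous_mult (K := R_AbsRing)) => //; exact: continuous_const.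
have Dphi x : 0 < x -> exists d, is_derive phi x d /\ d <= 0.
  move=> Hx; case: (Hu x Hx) => l [Hl Hle].
  exists (2 * ip l (u x)); split; last lra.
  have /(is_derive_within_iff _ _ _ _ Hx) H := is_derive_within_sqnorm _ _ _ _ Hx Hl.
  split; first exact: is_linear_scal_l.
  move=> x' Hx'; rewrite -(is_filter_lim_locally_unique _ _ Hx') => eps.
  case: (H eps (cond_pos eps)) => d [Hd H1].
  have Hm : 0 < Rmin d x by apply: Rmin_glb_lt.
  exists (mkposreal _ Hm) => y Hy.
  have Hy' : Rabs (y - x) < Rmin d x := Hy.
  have Hy1 : Rabs (y - x) < d by have := Rmin_l d x; lra.
  have Hy2 : 0 < y by have := Rmin_r d x; move: Hy'; split_Rabs; lra.
  have := H1 y Hy2 Hy1; rewrite /phi (Rmax_right 0 y) ?(Rmax_right 0 x); try lra.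
  by [].
case: (MVT_gen phi s t (fun x => match Rle_dec x 0 with left _ => 0 | right _ => Derive phi x end)).
- move=> x; rewrite Rmin_left ?Rmax_right => // Hx.
  have Hx0 : 0 < x by lra.
  case: Rle_dec => [|_]; first lra.
  case: (Dphi x Hx0) => d [Hd _]; apply: Derive_correct; by exists d.
- move=> x _; apply/continuity_pt_filterlim; exact: Cphi.
move=> c; rewrite Rmin_left ?Rmax_right // => [[Hc Heq]].
have Hle : phi t <= phi s.
  move: Heq; case: Rle_dec => Hc0; first lra.
  case: (Dphi c (Rnot_le_lt _ _ Hc0)) => d [Hd Hd0].
  rewrite (is_derive_unique _ _ _ Hd); nra.
rewrite /phi !Rmax_right in Hle; try lra.
apply: Rsqr_incr_0_var; last exact: norm_ge_0.
by rewrite !Rsqr_pow2.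
Qed.

End Energy.

(** * Completeness *)

Section Completeness.
Context {E : CompleteNormedModule R_AbsRing}.

Definition seq_lim (u : nat -> E) : E := lim (filtermap u eventually).

Lemma seq_lim_spec (u : nat -> E) :
  (forall eps, 0 < eps -> exists N, forall n m, (N <= n)%nat -> (N <= m)%nat ->
     norm (u n ⊖ u m) < eps) ->
  forall eps, 0 < eps -> exists N, forall n, (N <= n)%nat -> norm (u n ⊖ seq_lim u) < eps.
Proof.
move=> Hu eps He.
have Cu : cauchy (filtermap u eventually).
  move=> e; case: (Hu e (cond_pos e)) => N HN; exists (u N), N => n Hn.
  apply: (norm_compat1 (u N)); exact: HN.
have Hf : 0 < @norm_factor _ E by apply: norm_factor_gt_0.
have Hp : 0 < eps / @norm_factor _ E by apply: Rdiv_lt_0_compat.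
have PF : ProperFilter (filtermap u eventually) by apply: filtermap_proper_filter.
have [N HN] := complete_cauchy _ PF Cu (mkposreal _ Hp).
exists N => n Hn.
have := norm_compat2 _ _ (mkposreal _ Hp) (HN n Hn) => /=.
have -> : @norm_factor _ E * (eps / @norm_factor _ E) = eps by field; lra.
by [].
Qed.

(** Banach's fixed point theorem, by a geometric bound on the iterates. *)
Lemma contraction_fixed_point (phi : E -> E) (k : R) : 0 <= k < 1 ->
  (forall x y, norm (phi x ⊖ phi y) <= k * norm (x ⊖ y)) ->
  exists x, phi x = x.
Proof.
move=> Hk Hphi.
set u := fun n => Nat.iter n phi zero.
set d := norm (u 1%nat ⊖ u 0%nat).
have Hd : 0 <= d by apply: norm_ge_0.
have step n : norm (u (S n) ⊖ u n) <= k ^ n * d.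
  elim: n => [|n IH]; first by rewrite /= Rmult_1_l; apply: Rle_refl.
  apply: (Rle_trans _ _ _ (Hphi _ _)) => /=.
  rewrite Rmult_assoc; apply: Rmult_le_compat_l; [lra | exact: IH].
have far n p : norm (u (n + p)%nat ⊖ u n) <= k ^ n * d * (1 - k ^ p) / (1 - k).
  elim: p => [|p IH].
    rewrite Nat.add_0_r minus_eq_zero norm_zero /= Rminus_diag Rmult_0_r /Rdiv Rmult_0_l.
    exact: Rle_refl.
  apply: (Rle_trans _ _ _ (norm_triangle_minus _ (u (n + p)%nat) _)).
  have := step (n + p)%nat; rewrite Nat.add_succ_r pow_add => H1.
  have -> : k ^ n * d * (1 - k ^ S p) / (1 - k) =
     k ^ n * k ^ p * d + k ^ n * d * (1 - k ^ p) / (1 - k) by rewrite /=; field; lra.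
  lra.
have kpos n : 0 <= k ^ n by apply: pow_le; lra.
have far' n p : norm (u (n + p)%nat ⊖ u n) <= k ^ n * (d / (1 - k)).
  apply: (Rle_trans _ _ _ (far n p)).
  have := kpos p; have := kpos n => Hn Hp.
  have : 0 <= k ^ n * (d / (1 - k)) * k ^ p.
    apply: Rmult_le_pos => //; apply: Rmult_le_pos => //.
    apply: Rmult_le_pos => //; apply: Rlt_le; apply: Rinv_0_lt_compat; lra.
  have -> : k ^ n * d * (1 - k ^ p) / (1 - k) =
    k ^ n * (d / (1 - k)) - k ^ n * (d / (1 - k)) * k ^ p by field; lra.
  lra.
have small : forall eps, 0 < eps -> exists N, k ^ N * (d / (1 - k)) < eps.
  move=> eps He.
  have Hq : 0 <= d / (1 - k).
    apply: Rmult_le_pos => //; apply: Rlt_le; apply: Rinv_0_lt_compat; lra.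
  have Hr : 0 < eps / (d / (1 - k) + 1) by apply: Rdiv_lt_0_compat; lra.
  case: (pow_lt_1_zero k _ _ Hr) => [|N HN]; first by rewrite Rabs_pos_eq; lra.
  exists N; have := HN N (Nat.le_refl N); rewrite Rabs_pos_eq // => H.
  have E1 : eps / (d / (1 - k) + 1) * (d / (1 - k) + 1) = eps by field; lra.
  have := kpos N; nra.
have cau : forall eps, 0 < eps -> exists N, forall n m, (N <= n)%nat -> (N <= m)%nat ->
     norm (u n ⊖ u m) < eps.
  move=> eps He; case: (small (eps / 2)) => [|N HN]; first lra.
  exists N => n m Hn Hm.
  apply: (Rle_lt_trans _ _ _ (norm_triangle_minus _ (u N) _)).
  rewrite (norm_minus_swap (u N)).
  have := far' N (n - N)%nat; have := far' N (m - N)%nat.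
  rewrite !Nat.add_sub_assoc // !(Nat.add_comm N) !Nat.add_sub; lra.
have lim_u := seq_lim_spec u cau.
exists (seq_lim u); apply: eq_of_norm_minus_le => eps He.
case: (lim_u (eps / 2)) => [|N HN]; first lra.
apply: (Rle_trans _ _ _ (norm_triangle_minus _ (u (S N)) _)).
have H1 := HN (S N) (Nat.le_succ_diag_r N).
have H2 := HN N (Nat.le_refl N).
have := Hphi (seq_lim u) (u N); rewrite (norm_minus_swap _ (u N)) => H3.
have := norm_ge_0 (u N ⊖ seq_lim u) => H4.
change (phi (u N)) with (u (S N)) in H3.
nra.
Qed.

End Completeness.

(** * Resolvents of an m-accretive operator *)

Definition resolvent {E : CompleteNormedModule R_AbsRing} (A : operator E) (l : R) (f : E) : E :=
  iota (fun x : E => dom A x /\ x ⊕ l ⊙ A x = f).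

Section Resolvent.
Context {E : CompleteNormedModule R_AbsRing} {ip : E -> E -> R}.
Hypothesis Hip : is_inner_product ip.
Variable A : operator E.
Hypothesis Alin : linear_operator A.
Hypothesis Amacc : m_accretive ip A.

Ltac vec := vec_with Hip.

Lemma dom_minus (x y : E) : dom A x -> dom A y -> dom A (x ⊖ y).
Proof.
move=> Dx Dy; have -> : x ⊖ y = x ⊕ (-1) ⊙ y by vec.
apply: (dom_plus _ Alin) => //; exact: (dom_scal _ Alin).
Qed.

Lemma op_minus (x y : E) : dom A x -> dom A y -> A (x ⊖ y) = A x ⊖ A y.
Proof.
move=> Dx Dy; have -> : x ⊖ y = x ⊕ (-1) ⊙ y by vec.
rewrite (op_plus _ Alin) //; last exact: (dom_scal _ Alin).
rewrite (op_scal _ Alin) //; vec.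
Qed.

Lemma op_zero : A zero = zero.
Proof.
have -> : (zero : E) = 0 ⊙ (zero : E) by vec.
rewrite (op_scal _ Alin); [vec | exact: (dom_zero _ Alin)].
Qed.

(** Pair [x + l A x] with [x] and use the Cauchy-Schwarz inequality. *)
Lemma accretive_norm_le (l : R) (x : E) : 0 <= l -> dom A x -> norm x <= norm (x ⊕ l ⊙ A x).
Proof.
move=> Hl Dx.
have H1 := proj1 Amacc x Dx.
have H2 := Cauchy_Schwarz Hip (x ⊕ l ⊙ A x) x.
rewrite (inner_plus_l _ Hip) (ip_scal_l Hip) (inner_norm _ Hip) in H2.
have := norm_ge_0 x; have := norm_ge_0 (x ⊕ l ⊙ A x) => P1 P2.
have P3 : 0 <= l * ip (A x) x by apply: Rmult_le_pos.
case: (Req_dec (norm x) 0) => [->|Hx] //; nra.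
Qed.

Lemma accretive_inj (l : R) (x y : E) : 0 <= l -> dom A x -> dom A y ->
  x ⊕ l ⊙ A x = y ⊕ l ⊙ A y -> x = y.
Proof.
move=> Hl Dx Dy H; apply: eq_of_norm_minus_le => eps He.
have := accretive_norm_le l (x ⊖ y) Hl (dom_minus _ _ Dx Dy).
rewrite op_minus //.
have -> : x ⊖ y ⊕ l ⊙ (A x ⊖ A y) = (x ⊕ l ⊙ A x) ⊖ (y ⊕ l ⊙ A y) by vec.
rewrite H minus_eq_zero norm_zero; lra.
Qed.

Lemma resolvent_spec_of_range (l : R) (f : E) : 0 <= l ->
  (exists x, dom A x /\ x ⊕ l ⊙ A x = f) ->
  dom A (resolvent A l f) /\ resolvent A l f ⊕ l ⊙ A (resolvent A l f) = f.
Proof.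
move=> Hl [x [Dx Hx]].
apply: (iota_correct (fun x : E => dom A x /\ x ⊕ l ⊙ A x = f)).
exists x; split => // y [Dy Hy]; apply: (accretive_inj l) => //; by rewrite Hx Hy.
Qed.

(** The equation at [m] is a fixed point equation for the resolvent at [l],
    with Lipschitz constant [|1 - l / m|]. *)
Lemma range_step (l m : R) : 0 < l -> l / 2 < m ->
  (forall f, exists x, dom A x /\ x ⊕ l ⊙ A x = f) ->
  forall f, exists x, dom A x /\ x ⊕ m ⊙ A x = f.
Proof.
move=> Hl Hm Hr f.
have Hl0 : 0 <= l by lra.
have J g := resolvent_spec_of_range l g Hl0 (Hr g).
set k := Rabs (1 - l / m).
have Hq : 0 < l / m < 2.
  split; first by apply: Rdiv_lt_0_compat; lra.
  apply: (Rmult_lt_reg_r m); first lra.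
  have -> : l / m * m = l by field; lra.
  lra.
have Hk : 0 <= k < 1 by split; [exact: Rabs_pos | apply: Rabs_def1; lra].
case: (contraction_fixed_point
  (fun x => resolvent A l ((l / m) ⊙ f ⊕ (1 - l / m) ⊙ x)) k Hk).
- move=> x y; set g := _ ⊕ _; set g' := _ ⊕ (1 - l / m) ⊙ y.
  case: (J g) => D1 H1; case: (J g') => D2 H2.
  have := accretive_norm_le l _ Hl0 (dom_minus _ _ D1 D2).
  rewrite op_minus //.
  set a := resolvent A l g; set b := resolvent A l g'.
  have -> : a ⊖ b ⊕ l ⊙ (A a ⊖ A b) = (a ⊕ l ⊙ A a) ⊖ (b ⊕ l ⊙ A b) by vec.
  rewrite /a /b H1 H2.
  have -> : g ⊖ g' = (1 - l / m) ⊙ (x ⊖ y) by rewrite /g /g'; vec.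
  by rewrite norm_scal_R.
- move=> x Hx; exists x.
  case: (J ((l / m) ⊙ f ⊕ (1 - l / m) ⊙ x)); rewrite Hx => Dx H; split => //.
  have -> : x ⊕ m ⊙ A x = (m / l) ⊙ (x ⊕ l ⊙ A x ⊖ (1 - l / m) ⊙ x) by vec.
  rewrite H; vec.
Qed.

(** Starting from [l = 1], each use of [range_step] lowers the reachable
    parameters by the factor [2 / 3], any factor above [1 / 2] being allowed. *)
Lemma range_all (l : R) (f : E) : 0 < l -> exists x, dom A x /\ x ⊕ l ⊙ A x = f.
Proof.
move=> Hl.
have R_n n : forall m, (2 / 3) ^ n <= m -> forall g, exists x, dom A x /\ x ⊕ m ⊙ A x = g.
  elim: n => [|n IH] m Hm.
    apply: (range_step 1); [lra | move: Hm => /=; lra | ].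
    move=> g; case: (proj2 Amacc g) => x [Dx Hx]; exists x; split => //.
    by rewrite (scal_one (A x)).
  have Hp : 0 < (2 / 3) ^ n by apply: pow_lt; lra.
  apply: (range_step ((2 / 3) ^ n)) => //; first by move: Hm => /=; lra.
  apply: IH; exact: Rle_refl.
case: (pow_lt_1_zero (2 / 3) _ l Hl) => [|N HN]; first by rewrite Rabs_pos_eq; lra.
apply: (R_n N); have := HN N (Nat.le_refl N); rewrite Rabs_pos_eq; first lra.
apply: pow_le; lra.
Qed.

Lemma resolvent_dom (l : R) (f : E) : 0 < l -> dom A (resolvent A l f).
Proof.
move=> Hl; apply: (proj1 (resolvent_spec_of_range l f _ _)); [lra | exact: range_all].
Qed.

Lemma resolvent_eq (l : R) (f : E) : 0 < l ->
  resolvent A l f ⊕ l ⊙ A (resolvent A l f) = f.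
Proof.
move=> Hl; apply: (proj2 (resolvent_spec_of_range l f _ _)); [lra | exact: range_all].
Qed.

Lemma op_resolvent (l : R) (f : E) : 0 < l ->
  A (resolvent A l f) = (/ l) ⊙ (f ⊖ resolvent A l f).
Proof. move=> Hl; rewrite -{2}(resolvent_eq l f Hl); vec. Qed.

Lemma resolvent_unique (l : R) (x f : E) : 0 < l -> dom A x -> x ⊕ l ⊙ A x = f ->
  resolvent A l f = x.
Proof.
move=> Hl Dx Hx; apply: (accretive_inj l) => //; [lra | exact: resolvent_dom |].
by rewrite resolvent_eq.
Qed.

Lemma resolvent_plus (l : R) (f g : E) : 0 < l ->
  resolvent A l (f ⊕ g) = resolvent A l f ⊕ resolvent A l g.
Proof.
move=> Hl; have Df := resolvent_dom l f Hl; have Dg := resolvent_dom l g Hl.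
apply: resolvent_unique => //; first exact: (dom_plus _ Alin).
rewrite (op_plus _ Alin) // !op_resolvent //; vec.
Qed.

Lemma resolvent_scal (l k : R) (f : E) : 0 < l ->
  resolvent A l (k ⊙ f) = k ⊙ resolvent A l f.
Proof.
move=> Hl; have Df := resolvent_dom l f Hl.
apply: resolvent_unique => //; first exact: (dom_scal _ Alin).
rewrite (op_scal _ Alin) // !op_resolvent //; vec.
Qed.

Lemma resolvent_minus (l : R) (f g : E) : 0 < l ->
  resolvent A l (f ⊖ g) = resolvent A l f ⊖ resolvent A l g.
Proof.
move=> Hl; have -> : f ⊖ g = f ⊕ (-1) ⊙ g by vec.
rewrite resolvent_plus // resolvent_scal //; vec.
Qed.

Lemma resolvent_norm_le (l : R) (f : E) : 0 < l -> norm (resolvent A l f) <= norm f.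
Proof.
move=> Hl; rewrite -{2}(resolvent_eq l f Hl); apply: accretive_norm_le; first lra.
exact: resolvent_dom.
Qed.

Lemma op_resolvent_dom (l : R) (x : E) : 0 < l -> dom A x -> dom A (A (resolvent A l x)).
Proof.
move=> Hl Dx; rewrite op_resolvent //; apply: (dom_scal _ Alin); apply: dom_minus => //.
exact: resolvent_dom.
Qed.

Lemma op_resolvent_comm (l : R) (x : E) : 0 < l -> dom A x ->
  A (resolvent A l x) = resolvent A l (A x).
Proof.
move=> Hl Dx; symmetry; apply: resolvent_unique => //; first exact: op_resolvent_dom.
rewrite -{3}(resolvent_eq l x Hl) (op_plus _ Alin).
- by rewrite (op_scal _ Alin) //; apply: op_resolvent_dom.
- exact: resolvent_dom.
- apply: (dom_scal _ Alin); exact: op_resolvent_dom.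
Qed.

(** With [u] the composite resolvent, [u + m A u] solves the equation defining
    [resolvent A l f]. *)
Lemma resolvent_comm (l m : R) (f : E) : 0 < l -> 0 < m ->
  resolvent A l (resolvent A m f) = resolvent A m (resolvent A l f).
Proof.
move=> Hl Hm.
set v := resolvent A m f; set u := resolvent A l v.
have Du : dom A u by apply: resolvent_dom.
have Dv : dom A v by apply: resolvent_dom.
have DAu : dom A (A u) by apply: op_resolvent_dom.
have E1 : resolvent A l f = u ⊕ m ⊙ A u.
  apply: resolvent_unique => //.
    apply: (dom_plus _ Alin) => //; exact: (dom_scal _ Alin).
  rewrite (op_plus _ Alin) //; last exact: (dom_scal _ Alin).
  rewrite (op_scal _ Alin) //.
  have Ev : u ⊕ l ⊙ A u = v by apply: resolvent_eq.
  have Ef : v ⊕ m ⊙ A v = f by apply: resolvent_eq.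
  have EA : A v = A u ⊕ l ⊙ A (A u).
    rewrite -Ev (op_plus _ Alin) //; last exact: (dom_scal _ Alin).
    by rewrite (op_scal _ Alin).
  rewrite -Ef EA -Ev; vec.
by rewrite E1; symmetry; apply: resolvent_unique.
Qed.

Lemma resolvent_minus_id_norm_le (l : R) (x : E) : 0 < l -> dom A x ->
  norm (resolvent A l x ⊖ x) <= l * norm (A x).
Proof.
move=> Hl Dx.
have -> : resolvent A l x ⊖ x = (- l) ⊙ resolvent A l (A x).
  rewrite -op_resolvent_comm // op_resolvent //; vec.
rewrite norm_scal_R Rabs_Ropp Rabs_pos_eq; last lra.
apply: Rmult_le_compat_l; first lra.
exact: resolvent_norm_le.
Qed.

(** The defects [f - resolvent A l f] are Cauchy as [l] decreases, because the
    square of the distance of two of them is bounded by the decrease of their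
    squared norms. *)
Lemma resolvent_defect_contracts (l m : R) (f : E) : 0 < l -> l <= m ->
  norm ((f ⊖ resolvent A l f) ⊖ (f ⊖ resolvent A m f)) ^ 2 <=
  norm (f ⊖ resolvent A m f) ^ 2 - norm (f ⊖ resolvent A l f) ^ 2.
Proof.
move=> Hl Hlm.
have Hm : 0 < m by lra.
set y := resolvent A l f; set z := resolvent A m f.
have Dy : dom A y by apply: resolvent_dom.
have Dz : dom A z by apply: resolvent_dom.
have := proj1 Amacc _ (dom_minus _ _ Dy Dz).
rewrite op_minus // !op_resolvent // -/y -/z.
have -> : y ⊖ z = (f ⊖ z) ⊖ (f ⊖ y) by vec.
have Heq : l = m -> f ⊖ y = f ⊖ z by rewrite /y /z => ->.
move: (f ⊖ y) (f ⊖ z) Heq => e e' Heq.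
rewrite -!(inner_norm _ Hip).
rewrite !(ip_minus_l Hip, ip_minus_r Hip, ip_scal_l Hip) (inner_sym _ Hip e' e).
have P1 : 0 <= ip (e ⊖ e') (e ⊖ e') by rewrite (inner_norm _ Hip); apply: pow2_ge_0.
rewrite !(ip_minus_l Hip, ip_minus_r Hip) (inner_sym _ Hip e' e) in P1.
case: (Rle_lt_or_eq_dec _ _ Hlm) => Hlm'; last by rewrite (Heq Hlm'); lra.
move: P1; move: (ip e e) (ip e' e') (ip e e') => a b c P1.
have Hinv : / m < / l by apply: Rinv_lt_contravar => //; apply: Rmult_lt_0_compat.
have Hinv0 : 0 < / m by apply: Rinv_0_lt_compat.
move: Hinv Hinv0; set p := / l; set q := / m => Hpq Hq H.
have H2 : 0 <= (p - q) * (c - a) by nra.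
nra.
Qed.

End Resolvent.

(** * Implicit Euler steps *)

Definition step (k : nat) : R := (/ 2) ^ k.

Lemma step_pos (k : nat) : 0 < step k.
Proof. apply: pow_lt; lra. Qed.

Lemma step_S (k : nat) : step (S k) = step k / 2.
Proof. rewrite /step /=; lra. Qed.

Lemma step_small (eps : R) : 0 < eps -> eventually (fun k => step k < eps).
Proof.
move=> He; case: (pow_lt_1_zero (/ 2) _ eps He) => [|N HN]; first by rewrite Rabs_pos_eq; lra.
exists N => k Hk; have := HN k Hk; rewrite Rabs_pos_eq //; apply: Rlt_le; exact: step_pos.
Qed.

(** The value [0] at negative arguments makes the semigroup below the identity
    at negative times, hence strongly continuous on the whole line. *)
Definition floor_nat (x : R) : nat := Z.to_nat (Int_part x).

Lemma floor_nat_neg (x : R) : x < 0 -> floor_nat x = 0%nat.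
Proof.
move=> Hx; rewrite /floor_nat.
have [H1 _] := base_Int_part x.
have : (Int_part x < 0)%Z by apply: lt_IZR; lra.
lia.
Qed.

Lemma floor_nat_bounds (x : R) : 0 <= x -> INR (floor_nat x) <= x < INR (floor_nat x) + 1.
Proof.
move=> Hx; have [H1 H2] := base_Int_part x.
have H3 : (-1 < Int_part x)%Z by apply: lt_IZR; lra.
rewrite /floor_nat INR_IZR_INZ Z2Nat.id; last lia.
lra.
Qed.

Lemma floor_nat_le_Rabs (x : R) : INR (floor_nat x) <= Rabs x.
Proof.
case: (Rlt_le_dec x 0) => Hx.
  rewrite floor_nat_neg //=; exact: Rabs_pos.
have := floor_nat_bounds x Hx; have := Rle_abs x; lra.
Qed.

Lemma floor_nat_dist (x y : R) : Rabs (INR (floor_nat x) - INR (floor_nat y)) <= Rabs (x - y) + 1.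
Proof.
have H z : (z < 0 /\ INR (floor_nat z) = 0) \/ (0 <= z /\ INR (floor_nat z) <= z < INR (floor_nat z) + 1).
  case: (Rlt_le_dec z 0) => Hz; [left | right]; split => //.
  - by rewrite floor_nat_neg.
  - exact: floor_nat_bounds.
case: (H x) => [[Hx ->]|[Hx Hx']]; case: (H y) => [[Hy ->]|[Hy Hy']]; split_Rabs; lra.
Qed.

Section Semigroup.
Context {E : CompleteNormedModule R_AbsRing} {ip : E -> E -> R}.
Hypothesis Hip : is_inner_product ip.
Variable A : operator E.
Hypothesis Alin : linear_operator A.
Hypothesis Amacc : m_accretive ip A.

Ltac vec := vec_with Hip.
Local Notation J := (resolvent A).
Local Notation T l n := (Nat.iter n (resolvent A l)).

(** Let [e] be the limit of the defects [f - J l f].  Since [J 1 f] lies in the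
    domain, [J 1 e] is the limit of the defects of [J 1 f], that is zero; hence
    [e] is zero. *)
Lemma m_accretive_dense (f : E) (eps : R) : 0 < eps ->
  exists x, dom A x /\ norm (x ⊖ f) < eps.
Proof.
move=> He.
pose e (k : nat) : E := f ⊖ J (step k) f.
(* The squared norms of the defects decrease, so they converge; by [key] the
   defects themselves form a Cauchy sequence. *)
have key k m : (m <= k)%nat -> norm (e k ⊖ e m) ^ 2 <= norm (e m) ^ 2 - norm (e k) ^ 2.
  move=> Hkm; apply: (resolvent_defect_contracts Hip A Alin Amacc); first exact: step_pos.
  rewrite /step; have -> : k = (m + (k - m))%nat by lia.
  rewrite pow_add.
  have H1 : (/ 2) ^ (k - m) <= 1 by rewrite -(pow1 (k - m)); apply: pow_incr; lra.
  have := step_pos m; rewrite /step; nra.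
have [a Ha] : ex_finite_lim_seq (fun k => norm (e k) ^ 2).
  apply: (ex_finite_lim_seq_decr _ 0) => [k|k]; last exact: pow2_ge_0.
  have := key (S k) k (Nat.le_succ_diag_r k).
  have := pow2_ge_0 (norm (e (S k) ⊖ e k)); lra.
have cau : forall d, 0 < d -> exists N, forall n m, (N <= n)%nat -> (N <= m)%nat ->
    norm (e n ⊖ e m) < d.
  move=> d Hd.
  have Hd2 : 0 < d ^ 2 / 2 by nra.
  case: (proj2 (is_lim_seq_spec _ _) Ha (mkposreal _ Hd2)) => N HN; exists N => n m Hn Hm.
  have lt_sq x : norm x ^ 2 < d ^ 2 -> norm (x : E) < d.
    move=> Hx; have := norm_ge_0 x; nra.
  apply: lt_sq.
  have := HN n Hn; have := HN m Hm; rewrite /=.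
  case: (Nat.le_ge_cases m n) => Hnm.
  - have := key _ _ Hnm => /=; split_Rabs; lra.
  - have := key _ _ Hnm; rewrite (norm_minus_swap (e m)) => /=; split_Rabs; lra.
have lim_e := seq_lim_spec e cau.
set l := seq_lim e in lim_e.
have D1 : dom A (J 1 f) by apply: (resolvent_dom Hip A Alin Amacc); lra.
have J0 : J 1 l = (zero : E).
  apply: eq_of_norm_minus_le => d Hd.
  have Hq : 0 < d / 2 / (norm (A (J 1 f)) + 1).
    have := norm_ge_0 (A (J 1 f)) => H0; apply: Rdiv_lt_0_compat; lra.
  case: (lim_e (d / 2)) => [|N HN]; first lra.
  case: (step_small _ Hq) => M HM.
  set k := Nat.max N M.
  have Hk := HN k (Nat.le_max_l _ _); have Hk' := HM k (Nat.le_max_r _ _).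
  have -> : J 1 l ⊖ zero = J 1 (l ⊖ e k) ⊖ (J (step k) (J 1 f) ⊖ J 1 f).
    rewrite !(resolvent_minus Hip A Alin Amacc); try lra.
    rewrite (resolvent_comm Hip A Alin Amacc (step k)); try lra; last exact: step_pos.
    vec.
  apply: (Rle_trans _ _ _ (norm_triangle _ _)); rewrite norm_opp.
  have := resolvent_norm_le Hip A Alin Amacc 1 (l ⊖ e k) Rlt_0_1.
  rewrite (norm_minus_swap l).
  have := resolvent_minus_id_norm_le Hip A Alin Amacc (step k) _ (step_pos k) D1.
  have E1 : d / 2 / (norm (A (J 1 f)) + 1) * (norm (A (J 1 f)) + 1) = d / 2.
    field; have := norm_ge_0 (A (J 1 f)); lra.
  have := norm_ge_0 (A (J 1 f)); nra.
have l0 : l = (zero : E).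
  rewrite -(resolvent_eq Hip A Alin Amacc 1 l Rlt_0_1) J0 (op_zero Hip A Alin); vec.
case: (lim_e eps He) => N HN; exists (J (step N) f); split.
  apply: (resolvent_dom Hip A Alin Amacc); exact: step_pos.
have := HN N (Nat.le_refl N); rewrite l0 norm_minus_swap.
by have -> : zero ⊖ e N = J (step N) f ⊖ f by rewrite /e; vec.
Qed.

(** A resolvent maps the domain of [A] into the domain of [A ^ 2]. *)
Lemma dom_sqr_dense (f : E) (eps : R) : 0 < eps ->
  exists x, dom A x /\ dom A (A x) /\ norm (x ⊖ f) < eps.
Proof.
move=> He.
case: (m_accretive_dense f (eps / 2)) => [|y [Dy Hy]]; first lra.
have Hn := norm_ge_0 (A y).
have Hl : 0 < eps / 2 / (norm (A y) + 1) by apply: Rdiv_lt_0_compat; lra.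
set l := eps / 2 / (norm (A y) + 1) in Hl.
exists (J l y); split; first exact: (resolvent_dom Hip A Alin Amacc).
split; first exact: (op_resolvent_dom Hip A Alin Amacc).
apply: (Rle_lt_trans _ _ _ (norm_triangle_minus _ y _)).
have := resolvent_minus_id_norm_le Hip A Alin Amacc l y Hl Dy.
have E1 : l * (norm (A y) + 1) = eps / 2 by rewrite /l; field; lra.
nra.
Qed.

Section FixedStep.
Variable l : R.
Hypothesis Hl : 0 < l.

Lemma iter_minus (n : nat) (x y : E) : T l n (x ⊖ y) = T l n x ⊖ T l n y.
Proof. by elim: n => //= n ->; apply: (resolvent_minus Hip A Alin Amacc). Qed.

Lemma iter_plus (n : nat) (x y : E) : T l n (x ⊕ y) = T l n x ⊕ T l n y.
Proof. by elim: n => //= n ->; apply: (resolvent_plus Hip A Alin Amacc). Qed.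

Lemma iter_scal (n : nat) (k : R) (x : E) : T l n (k ⊙ x) = k ⊙ T l n x.
Proof. by elim: n => //= n ->; apply: (resolvent_scal Hip A Alin Amacc). Qed.

Lemma iter_norm_le (n : nat) (x : E) : norm (T l n x) <= norm x.
Proof.
elim: n => [|n IH] /=; first exact: Rle_refl.
apply: Rle_trans IH; exact: (resolvent_norm_le Hip A Alin Amacc).
Qed.

Lemma iter_dom (n : nat) (x : E) : dom A x -> dom A (T l n x).
Proof. by case: n => //= n _; apply: (resolvent_dom Hip A Alin Amacc). Qed.

Lemma op_iter (n : nat) (x : E) : dom A x -> A (T l n x) = T l n (A x).
Proof.
move=> Dx; elim: n => //= n IH.
rewrite (op_resolvent_comm Hip A Alin Amacc) ?IH //; exact: iter_dom.
Qed.

Lemma iter_minus_id_norm_le (n : nat) (x : E) : dom A x ->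
  norm (T l n x ⊖ x) <= INR n * l * norm (A x).
Proof.
move=> Dx; elim: n => [|n IH].
  rewrite /= minus_eq_zero norm_zero; lra.
apply: (Rle_trans _ _ _ (norm_triangle_minus _ (T l n x) _)).
have := resolvent_minus_id_norm_le Hip A Alin Amacc l _ Hl (iter_dom n x Dx).
rewrite op_iter // => H1; have := iter_norm_le n (A x).
rewrite S_INR /=; nra.
Qed.

Lemma iter_dist (n m : nat) (x : E) : dom A x ->
  norm (T l n x ⊖ T l m x) <= Rabs (INR n - INR m) * l * norm (A x).
Proof.
move=> Dx.
have H p q : (q <= p)%nat -> norm (T l p x ⊖ T l q x) <= (INR p - INR q) * l * norm (A x).
  move=> Hpq; rewrite -minus_INR //.
  have -> : T l p x = T l q (T l (p - q) x).
    rewrite -Nat.iter_add; by have -> : (q + (p - q) = p)%nat by lia.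
  rewrite -iter_minus; apply: (Rle_trans _ _ _ (iter_norm_le _ _)).
  exact: iter_minus_id_norm_le.
case: (Nat.le_ge_cases m n) => Hnm.
  rewrite Rabs_pos_eq; first exact: H.
  have := le_INR _ _ Hnm; lra.
rewrite norm_minus_swap Rabs_minus_sym Rabs_pos_eq; first exact: H.
have := le_INR _ _ Hnm; lra.
Qed.

Lemma iter_minus_id_approx (n : nat) (x y : E) : dom A y ->
  norm (T l n x ⊖ x) <= INR n * l * norm (A y) + 2 * norm (x ⊖ y).
Proof.
move=> Dy.
have -> : T l n x ⊖ x = T l n (x ⊖ y) ⊕ (T l n y ⊖ y) ⊕ (y ⊖ x).
  rewrite iter_minus; vec.
apply: (Rle_trans _ _ _ (norm_triangle _ _)).
have := norm_triangle (T l n (x ⊖ y)) (T l n y ⊖ y).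
have := iter_norm_le n (x ⊖ y); have := iter_minus_id_norm_le n y Dy.
rewrite (norm_minus_swap y x); lra.
Qed.

(** Each step adds [- l] times an iterate of [A x], hence the error is the sum
    of the deviations of these iterates from [A x]. *)
Lemma iter_first_order (n : nat) (x : E) (M : R) : dom A x ->
  (forall j, (j <= n)%nat -> norm (T l j (A x) ⊖ A x) <= M) ->
  norm (T l n x ⊖ x ⊕ (INR n * l) ⊙ A x) <= INR n * l * M.
Proof.
move=> Dx; elim: n => [|n IH] HM.
  have -> : T l 0 x ⊖ x ⊕ (INR 0 * l) ⊙ A x = (zero : E) by rewrite /=; vec.
  rewrite norm_zero /=; lra.
have -> : T l (S n) x ⊖ x ⊕ (INR (S n) * l) ⊙ A x =
  (T l n x ⊖ x ⊕ (INR n * l) ⊙ A x) ⊖ l ⊙ (T l (S n) (A x) ⊖ A x).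
  have E1 : T l (S n) x = T l n x ⊖ l ⊙ T l (S n) (A x).
    rewrite -op_iter // /= (op_resolvent Hip A Alin Amacc) //; vec.
  rewrite {1}E1 S_INR; vec.
apply: (Rle_trans _ _ _ (norm_triangle _ _)); rewrite norm_opp norm_scal_R Rabs_pos_eq; last lra.
have := IH (fun j Hj => HM j (Nat.le_le_succ_r _ _ Hj)).
have := HM (S n) (Nat.le_refl _).
rewrite S_INR; nra.
Qed.

End FixedStep.

(** One step of size [l] against two of size [l / 2]: by
    [(1 + l / 2 A) ^ 2 = 1 + l A + l ^ 2 / 4 A ^ 2] they differ at second order. *)
Lemma resolvent_halving (l : R) (x : E) : 0 < l -> dom A x -> dom A (A x) ->
  norm (J l x ⊖ J (l / 2) (J (l / 2) x)) <= l ^ 2 / 4 * norm (A (A x)).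
Proof.
move=> Hl Dx DAx.
have Hl2 : 0 < l / 2 by lra.
set p := J (l / 2) x; set q := J (l / 2) p.
have Dp : dom A p by apply: (resolvent_dom Hip A Alin Amacc).
have Dq : dom A q by apply: (resolvent_dom Hip A Alin Amacc).
have DJ : dom A (J l x) by apply: (resolvent_dom Hip A Alin Amacc).
have DAq : dom A (A q) by apply: (op_resolvent_dom Hip A Alin Amacc).
have Ep : p = q ⊕ (l / 2) ⊙ A q by rewrite (resolvent_eq Hip A Alin Amacc).
have EAp : A p = A q ⊕ (l / 2) ⊙ A (A q).
  rewrite {1}Ep (op_plus _ Alin) ?(op_scal _ Alin) //; exact: (dom_scal _ Alin).
have Ex : x = p ⊕ (l / 2) ⊙ A p by rewrite (resolvent_eq Hip A Alin Amacc).
have EJ : J l x ⊕ l ⊙ A (J l x) = x by apply: (resolvent_eq Hip A Alin Amacc).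
have H1 : A (A q) = J (l / 2) (J (l / 2) (A (A x))).
  have comm y : dom A y -> A (J (l / 2) y) = J (l / 2) (A y).
    exact: (op_resolvent_comm Hip A Alin Amacc).
  rewrite /q /p !comm //; exact: (resolvent_dom Hip A Alin Amacc).
have := accretive_norm_le Hip A Amacc l (J l x ⊖ q) (Rlt_le _ _ Hl)
  (dom_minus Hip A Alin _ _ DJ Dq).
rewrite (op_minus Hip A Alin) //.
have -> : J l x ⊖ q ⊕ l ⊙ (A (J l x) ⊖ A q) = (l ^ 2 / 4) ⊙ A (A q).
  have -> : J l x ⊖ q ⊕ l ⊙ (A (J l x) ⊖ A q) = (J l x ⊕ l ⊙ A (J l x)) ⊖ q ⊖ l ⊙ A q by vec.
  rewrite EJ {1}Ex EAp {1}Ep; vec.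
rewrite norm_scal_R Rabs_pos_eq; last nra.
rewrite H1 => H2.
have := resolvent_norm_le Hip A Alin Amacc (l / 2) (J (l / 2) (A (A x))) Hl2.
have := resolvent_norm_le Hip A Alin Amacc (l / 2) (A (A x)) Hl2.
have : 0 < l ^ 2 / 4 by nra.
nra.
Qed.

Lemma iter_halving (l : R) (n : nat) (x : E) : 0 < l -> dom A x -> dom A (A x) ->
  norm (T l n x ⊖ T (l / 2) (2 * n) x) <= INR n * (l ^ 2 / 4) * norm (A (A x)).
Proof.
move=> Hl Dx DAx; have Hl2 : 0 < l / 2 by lra.
elim: n => [|n IH].
  rewrite /= minus_eq_zero norm_zero; lra.
have -> : (2 * S n = S (S (2 * n)))%nat by lia.
set y := T (l / 2) (2 * n) x in IH *.
have Dy : dom A y by apply: iter_dom.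
have EAy : A y = T (l / 2) (2 * n) (A x) by apply: op_iter.
have DAy : dom A (A y) by rewrite EAy; apply: iter_dom.
have EAAy : A (A y) = T (l / 2) (2 * n) (A (A x)) by rewrite EAy; apply: op_iter.
have := resolvent_halving l y Hl Dy DAy; rewrite EAAy => H1.
have H2 := iter_norm_le _ Hl2 (2 * n) (A (A x)).
change (T l (S n) x) with (J l (T l n x)).
change (T (l / 2) (S (S (2 * n))) x) with (J (l / 2) (J (l / 2) y)).
apply: (Rle_trans _ _ _ (norm_triangle_minus _ (J l y) _)).
rewrite -(resolvent_minus Hip A Alin Amacc) //.
have H3 := resolvent_norm_le Hip A Alin Amacc l (T l n x ⊖ y) Hl.
rewrite S_INR; have : 0 < l ^ 2 / 4 by nra.
nra.
Qed.
End Semigroup.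

(** * The contraction semigroup *)

Definition euler {E : CompleteNormedModule R_AbsRing} (A : operator E) (k : nat) (t : R) : E -> E :=
  Nat.iter (floor_nat (t / step k)) (resolvent A (step k)).

Definition semigroup {E : CompleteNormedModule R_AbsRing} (A : operator E) (t : R) (x : E) : E :=
  seq_lim (fun k => euler A k t x).

Section Generation.
Context {E : CompleteNormedModule R_AbsRing} {ip : E -> E -> R}.
Hypothesis Hip : is_inner_product ip.
Variable A : operator E.
Hypothesis Alin : linear_operator A.
Hypothesis Amacc : m_accretive ip A.

Ltac vec := vec_with Hip.
Local Notation S := (semigroup A).
Local Notation U := (euler A).

Lemma euler_time (k : nat) (t : R) : INR (floor_nat (t / step k)) * step k <= Rabs t.
Proof.
have Hk := step_pos k.
have := floor_nat_le_Rabs (t / step k).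
rewrite /Rdiv Rabs_mult (Rabs_pos_eq (/ step k)); last by apply: Rlt_le; apply: Rinv_0_lt_compat.
move=> /(Rmult_le_compat_r (step k)) H.
have -> : Rabs t = Rabs t * / step k * step k by field; lra.
apply: H; lra.
Qed.

(** The term in [A (A x)] comes from halving all the steps, the term in [A x]
    from the rounding of the number of steps. *)
Lemma euler_consecutive (k : nat) (t : R) (x : E) : dom A x -> dom A (A x) ->
  norm (U k t x ⊖ U (Datatypes.S k) t x) <=
  step k * (Rabs t * norm (A (A x)) + norm (A x)).
Proof.
move=> Dx DAx; have Hk := step_pos k.
have Hk2 : 0 < step k / 2 by lra.
have Nt := Rabs_pos t; have N1 := norm_ge_0 (A x); have N2 := norm_ge_0 (A (A x)).
rewrite /euler step_S.
set n := floor_nat (t / step k); set m := floor_nat (t / (step k / 2)).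
apply: (Rle_trans _ _ _ (norm_triangle_minus _ (Nat.iter (2 * n) (resolvent A (step k / 2)) x) _)).
have H1 := iter_halving Hip A Alin Amacc (step k) n x Hk Dx DAx.
have H2 := iter_dist Hip A Alin Amacc (step k / 2) Hk2 (2 * n) m x Dx.
(* Rounding the doubled quotient differs from doubling the rounded one by at
   most two steps. *)
have H3 : Rabs (INR (2 * n) - INR m) <= 2.
  rewrite mult_INR /n /m /=.
  case: (Rlt_le_dec t 0) => Ht.
    have Hn : t / step k < 0.
      have := Rinv_0_lt_compat _ Hk; rewrite /Rdiv; nra.
    have Hm : t / (step k / 2) < 0.
      have := Rinv_0_lt_compat _ Hk2; rewrite /Rdiv; nra.
    rewrite !floor_nat_neg // /= Rmult_0_r Rminus_diag Rabs_R0; lra.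
  have Hn : 0 <= t / step k by apply: Rmult_le_pos => //; apply: Rlt_le; apply: Rinv_0_lt_compat.
  have Em : t / (step k / 2) = 2 * (t / step k) by field; lra.
  have := floor_nat_bounds _ Hn.
  have Hm : 0 <= t / (step k / 2) by lra.
  have := floor_nat_bounds _ Hm.
  move=> B1 B2; apply: Rabs_le; lra.
have H4 := euler_time k t; rewrite -/n in H4.
have H5 : INR n * (step k ^ 2 / 4) * norm (A (A x)) <= step k * Rabs t * norm (A (A x)).
  apply: Rmult_le_compat_r => //.
  have -> : INR n * (step k ^ 2 / 4) = INR n * step k * (step k / 4) by field.
  have := pos_INR n; nra.
have H6 : Rabs (INR (2 * n) - INR m) * (step k / 2) * norm (A x) <= 2 * (step k / 2) * norm (A x).
  apply: Rmult_le_compat_r => //; apply: Rmult_le_compat_r => //; lra.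
lra.
Qed.

Lemma euler_cauchy_smooth (t : R) (x : E) : dom A x -> dom A (A x) ->
  forall k m, (k <= m)%nat ->
  norm (U k t x ⊖ U m t x) <= 2 * step k * (Rabs t * norm (A (A x)) + norm (A x)).
Proof.
move=> Dx DAx; set C := Rabs t * _ + _.
have HC : 0 <= C.
  have := Rabs_pos t; have := norm_ge_0 (A x); have := norm_ge_0 (A (A x)); rewrite /C; nra.
have H k p : norm (U k t x ⊖ U (k + p)%nat t x) <= (2 * step k - 2 * step (k + p)) * C.
  elim: p => [|p IH].
    rewrite Nat.add_0_r minus_eq_zero norm_zero; lra.
  rewrite Nat.add_succ_r step_S.
  apply: (Rle_trans _ _ _ (norm_triangle_minus _ (U (k + p)%nat t x) _)).
  have := euler_consecutive (k + p) t x Dx DAx; rewrite -/C; lra.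
move=> k m Hkm; have := H k (m - k)%nat.
have -> : (k + (m - k) = m)%nat by lia.
have := step_pos m; nra.
Qed.

Lemma euler_minus (k : nat) (t : R) (x y : E) : U k t (x ⊖ y) = U k t x ⊖ U k t y.
Proof. by apply: (iter_minus Hip A Alin Amacc); apply: step_pos. Qed.

Lemma euler_norm_le (k : nat) (t : R) (x : E) : norm (U k t x) <= norm x.
Proof. by apply: (iter_norm_le Hip A Alin Amacc); apply: step_pos. Qed.

(** The approximations are contractions, so convergence on the dense domain of
    [A ^ 2] extends to every vector. *)
Lemma euler_cv (t : R) (x : E) (eps : R) : 0 < eps ->
  eventually (fun k => norm (U k t x ⊖ S t x) < eps).
Proof.
move: eps; apply: seq_lim_spec => eps He.
case: (dom_sqr_dense Hip A Alin Amacc x (eps / 8)) => [|y [Dy [DAy Hy]]]; first lra.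
set C := Rabs t * norm (A (A y)) + norm (A y).
have HC : 0 <= C.
  have := Rabs_pos t; have := norm_ge_0 (A y); have := norm_ge_0 (A (A y)); rewrite /C; nra.
have Hq : 0 < eps / 8 / (C + 1) by apply: Rdiv_lt_0_compat; lra.
case: (step_small _ Hq) => N HN; exists N.
have near n : (N <= n)%nat -> norm (U n t x ⊖ U N t x) < eps / 2.
  move=> Hn; rewrite norm_minus_swap.
  have -> : U N t x ⊖ U n t x = (U N t y ⊖ U n t y) ⊖ U N t (y ⊖ x) ⊕ U n t (y ⊖ x).
    rewrite !euler_minus; vec.
  apply: (Rle_lt_trans _ _ _ (norm_triangle _ _)).
  have := norm_triangle (U N t y ⊖ U n t y) (opp (U N t (y ⊖ x))); rewrite norm_opp.
  change (U N t y ⊖ U n t y ⊖ U N t (y ⊖ x)) with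
    ((U N t y ⊖ U n t y) ⊕ opp (U N t (y ⊖ x))).
  have := euler_norm_le N t (y ⊖ x); have := euler_norm_le n t (y ⊖ x).
  have := euler_cauchy_smooth t y Dy DAy N n Hn; rewrite -/C.
  have := HN N (Nat.le_refl N); have := step_pos N => P1 P2.
  have E1 : eps / 8 / (C + 1) * (C + 1) = eps / 8 by field; lra.
  nra.
move=> n m Hn Hm.
apply: (Rle_lt_trans _ _ _ (norm_triangle_minus _ (U N t x) _)).
rewrite (norm_minus_swap (U N t x)); have := near n Hn; have := near m Hm; lra.
Qed.

Lemma semigroup_plus_r (t : R) (x y : E) : S t (x ⊕ y) = S t x ⊕ S t y.
Proof.
apply: eq_of_norm_minus_le => eps He.
have He3 : 0 < eps / 3 by lra.
have [k [[H1 H2] H3]] := filter_ex _ (filter_and _ _ (filter_and _ _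
  (euler_cv t (x ⊕ y) _ He3) (euler_cv t x _ He3)) (euler_cv t y _ He3)).
have -> : S t (x ⊕ y) ⊖ (S t x ⊕ S t y) =
  (U k t x ⊖ S t x) ⊕ (U k t y ⊖ S t y) ⊖ (U k t (x ⊕ y) ⊖ S t (x ⊕ y)).
  rewrite /euler (iter_plus Hip A Alin Amacc); last exact: step_pos. vec.
apply: (Rle_trans _ _ _ (norm_triangle _ _)); rewrite norm_opp.
have := norm_triangle (U k t x ⊖ S t x) (U k t y ⊖ S t y); lra.
Qed.

Lemma semigroup_scal_r (t k : R) (x : E) : S t (k ⊙ x) = k ⊙ S t x.
Proof.
apply: eq_of_norm_minus_le => eps He.
have He2 : 0 < eps / 2 by lra.
have He3 : 0 < eps / 2 / (Rabs k + 1) by apply: Rdiv_lt_0_compat => //; have := Rabs_pos k; lra.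
have [n [H1 H2]] := filter_ex _ (filter_and _ _
  (euler_cv t (k ⊙ x) _ He2) (euler_cv t x _ He3)).
have -> : S t (k ⊙ x) ⊖ k ⊙ S t x =
  k ⊙ (U n t x ⊖ S t x) ⊖ (U n t (k ⊙ x) ⊖ S t (k ⊙ x)).
  rewrite /euler (iter_scal Hip A Alin Amacc); last exact: step_pos. vec.
apply: (Rle_trans _ _ _ (norm_triangle _ _)); rewrite norm_opp norm_scal_R.
have E1 : eps / 2 / (Rabs k + 1) * (Rabs k + 1) = eps / 2.
  field; have := Rabs_pos k; lra.
have := Rabs_pos k; have := norm_ge_0 (U n t x ⊖ S t x); nra.
Qed.

Lemma semigroup_norm_le (t : R) (x : E) : norm (S t x) <= norm x.
Proof.
apply: le_epsilon => eps He.
have [k H] := filter_ex _ (euler_cv t x _ He).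
have := norm_triangle_minus (S t x) (U k t x) zero; rewrite (norm_minus_swap (S t x) (U k t x)).
have N0 (y : E) : y ⊖ zero = y by vec.
rewrite !N0; have := euler_norm_le k t x; lra.
Qed.

Lemma semigroup_neg (t : R) (x : E) : t <= 0 -> S t x = x.
Proof.
move=> Ht; apply: eq_of_norm_minus_le => eps He.
have [k H] := filter_ex _ (euler_cv t x _ He).
have E0 : floor_nat (t / step k) = 0%nat.
  have Hk := Rinv_0_lt_compat _ (step_pos k).
  case: (Rlt_le_dec (t / step k) 0) => [|H0]; first exact: floor_nat_neg.
  have [H1 _] := floor_nat_bounds _ H0.
  have H2 : t / step k <= 0 by rewrite /Rdiv; nra.
  apply: INR_eq; have := pos_INR (floor_nat (t / step k)); rewrite /=; lra.
move: H; rewrite /euler E0 /= norm_minus_swap; exact: Rlt_le.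
Qed.

Lemma semigroup_minus_r (t : R) (x y : E) : S t (x ⊖ y) = S t x ⊖ S t y.
Proof.
have -> : x ⊖ y = x ⊕ (-1) ⊙ y by vec.
rewrite semigroup_plus_r semigroup_scal_r; vec.
Qed.

Lemma semigroup_lipschitz (s t : R) (x : E) : dom A x ->
  norm (S t x ⊖ S s x) <= Rabs (t - s) * norm (A x).
Proof.
move=> Dx; apply: le_epsilon => eps He.
have He3 : 0 < eps / 3 by lra.
have N := norm_ge_0 (A x).
have Hq : 0 < eps / 3 / (norm (A x) + 1) by apply: Rdiv_lt_0_compat; lra.
have [k [[H1 H2] H3]] := filter_ex _ (filter_and _ _ (filter_and _ _
  (euler_cv t x _ He3) (euler_cv s x _ He3)) (step_small _ Hq)).
have Hk := step_pos k.
apply: (Rle_trans _ _ _ (norm_triangle_minus _ (U k t x) _)).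
have := norm_triangle_minus (U k t x) (U k s x) (S s x).
rewrite (norm_minus_swap (S t x)).
have := iter_dist Hip A Alin Amacc (step k) Hk (floor_nat (t / step k)) (floor_nat (s / step k)) x Dx.
change (norm (U k t x ⊖ U k s x) <= Rabs (INR (floor_nat (t / step k)) - INR (floor_nat (s / step k))) *
  step k * norm (A x) -> norm (U k t x ⊖ S s x) <= norm (U k t x ⊖ U k s x) + norm (U k s x ⊖ S s x) ->
  norm (U k t x ⊖ S t x) + norm (U k t x ⊖ S s x) <= Rabs (t - s) * norm (A x) + eps).
have := floor_nat_dist (t / step k) (s / step k).
have -> : t / step k - s / step k = (t - s) * / step k by field; lra.
rewrite Rabs_mult (Rabs_pos_eq (/ step k)); last by apply: Rlt_le; apply: Rinv_0_lt_compat.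
set r := Rabs (INR _ - _) => Hr.
have Hr2 : r * step k <= Rabs (t - s) + step k.
  have -> : Rabs (t - s) + step k = (Rabs (t - s) * / step k + 1) * step k by field; lra.
  apply: Rmult_le_compat_r; lra.
have Hr3 : r * step k * norm (A x) <= (Rabs (t - s) + step k) * norm (A x).
  by apply: Rmult_le_compat_r.
have E1 : eps / 3 / (norm (A x) + 1) * (norm (A x) + 1) = eps / 3 by field; lra.
have : step k * norm (A x) <= eps / 3 by nra.
lra.
Qed.

Lemma semigroup_continuous (x : E) (t : R) : continuous (fun s => S s x) t.
Proof.
apply/continuous_iff => eps He.
case: (m_accretive_dense Hip A Alin Amacc x (eps / 3)) => [|y [Dy Hy]]; first lra.
have N := norm_ge_0 (A y).
have Hq : 0 < eps / 3 / (norm (A y) + 1) by apply: Rdiv_lt_0_compat; lra.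
exists (eps / 3 / (norm (A y) + 1)); split => // s Hs.
have -> : S s x ⊖ S t x = (S s y ⊖ S t y) ⊖ S s (y ⊖ x) ⊕ S t (y ⊖ x).
  rewrite !semigroup_minus_r; vec.
apply: (Rle_lt_trans _ _ _ (norm_triangle _ _)).
have := norm_triangle (S s y ⊖ S t y) (opp (S s (y ⊖ x))); rewrite norm_opp.
change (S s y ⊖ S t y ⊖ S s (y ⊖ x)) with ((S s y ⊖ S t y) ⊕ opp (S s (y ⊖ x))).
have := semigroup_norm_le s (y ⊖ x); have := semigroup_norm_le t (y ⊖ x).
have := semigroup_lipschitz t s y Dy.
have E1 : eps / 3 / (norm (A y) + 1) * (norm (A y) + 1) = eps / 3 by field; lra.
have : Rabs (s - t) * norm (A y) <= eps / 3.
  have := Rabs_pos (s - t); nra.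
lra.
Qed.

(** The numbers of steps used for [s + t] and for [s] and [t] together differ by
    at most two. *)
Lemma semigroup_add_dom (s t : R) (x : E) : 0 <= s -> 0 <= t -> dom A x ->
  S (s + t) x = S s (S t x).
Proof.
move=> Hs Ht Dx; apply: eq_of_norm_minus_le => eps He.
have He4 : 0 < eps / 4 by lra.
have N := norm_ge_0 (A x).
have Hq : 0 < eps / 4 / (2 * norm (A x) + 1) by apply: Rdiv_lt_0_compat; lra.
have [k [[[H1 H2] H3] H4]] := filter_ex _ (filter_and _ _ (filter_and _ _ (filter_and _ _
  (euler_cv (s + t) x _ He4) (euler_cv s (S t x) _ He4)) (euler_cv t x _ He4))
  (step_small _ Hq)).
have Hk := step_pos k.
have H5 : norm (U k (s + t) x ⊖ U k s (U k t x)) <= eps / 4.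
  rewrite /euler -Nat.iter_add.
  apply: (Rle_trans _ _ _ (iter_dist Hip A Alin Amacc (step k) Hk _ _ x Dx)).
  have Hp := Rinv_0_lt_compat _ Hk.
  have B1 := floor_nat_bounds (s / step k) ltac:(rewrite /Rdiv; nra).
  have B2 := floor_nat_bounds (t / step k) ltac:(rewrite /Rdiv; nra).
  have B3 := floor_nat_bounds ((s + t) / step k) ltac:(rewrite /Rdiv; nra).
  have Eq : (s + t) / step k = s / step k + t / step k by field; lra.
  have B4 : Rabs (INR (floor_nat ((s + t) / step k)) -
     INR (floor_nat (s / step k) + floor_nat (t / step k))) <= 2.
    rewrite plus_INR; apply: Rabs_le; lra.
  have E1 : eps / 4 / (2 * norm (A x) + 1) * (2 * norm (A x) + 1) = eps / 4 by field; lra.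
  have B5 := Rabs_pos (INR (floor_nat ((s + t) / step k)) -
     INR (floor_nat (s / step k) + floor_nat (t / step k))).
  apply: (Rle_trans _ (2 * step k * norm (A x))); last nra.
  apply: Rmult_le_compat_r => //; apply: Rmult_le_compat_r; lra.
have H6 : norm (U k s (U k t x) ⊖ U k s (S t x)) <= eps / 4.
  rewrite -euler_minus; have := euler_norm_le k s (U k t x ⊖ S t x); lra.
apply: (Rle_trans _ _ _ (norm_triangle_minus _ (U k (s + t) x) _)).
have := norm_triangle_minus (U k (s + t) x) (U k s (U k t x)) (S s (S t x)).
have := norm_triangle_minus (U k s (U k t x)) (U k s (S t x)) (S s (S t x)).
rewrite (norm_minus_swap (S (s + t) x)); lra.
Qed.

Lemma semigroup_add (s t : R) (x : E) : 0 <= s -> 0 <= t -> S (s + t) x = S s (S t x).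
Proof.
move=> Hs Ht; apply: eq_of_norm_minus_le => eps He.
case: (m_accretive_dense Hip A Alin Amacc x (eps / 2)) => [|y [Dy Hy]]; first lra.
have -> : S (s + t) x ⊖ S s (S t x) = S s (S t (y ⊖ x)) ⊖ S (s + t) (y ⊖ x).
  rewrite !semigroup_minus_r (semigroup_add_dom s t y) //; vec.
apply: (Rle_trans _ _ _ (norm_triangle _ _)); rewrite norm_opp.
have := semigroup_norm_le (s + t) (y ⊖ x).
have := semigroup_norm_le s (S t (y ⊖ x)); have := semigroup_norm_le t (y ⊖ x); lra.
Qed.

(** A bound in terms of an auxiliary [y] in the domain close to [A x], because
    [A x] itself need not lie there. *)
Lemma semigroup_first_order (x y : E) (t : R) : 0 <= t -> dom A x -> dom A y ->
  norm (S t x ⊖ x ⊕ t ⊙ A x) <= t * (t * norm (A y) + 2 * norm (A x ⊖ y)).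
Proof.
move=> Ht Dx Dy; apply: le_epsilon => eps He.
have He2 : 0 < eps / 2 by lra.
have N := norm_ge_0 (A x); have N1 := norm_ge_0 (A y); have N2 := norm_ge_0 (A x ⊖ y).
have Hq : 0 < eps / 2 / (norm (A x) + 1) by apply: Rdiv_lt_0_compat; lra.
have [k [H1 H2]] := filter_ex _ (filter_and _ _ (euler_cv t x _ He2) (step_small _ Hq)).
have Hk := step_pos k.
have Hp : 0 <= t / step k.
  by apply: Rmult_le_pos => //; apply: Rlt_le; apply: Rinv_0_lt_compat.
have [B1 B2] := floor_nat_bounds _ Hp.
have H3 := euler_time k t; rewrite Rabs_pos_eq // in H3.
set n := floor_nat (t / step k) in B1 B2 H3.
have B3 : t < INR n * step k + step k.
  have -> : t = t / step k * step k by field; lra.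
  nra.
have H4 : norm (U k t x ⊖ x ⊕ (INR n * step k) ⊙ A x) <=
    INR n * step k * (t * norm (A y) + 2 * norm (A x ⊖ y)).
  apply: (iter_first_order Hip A Alin Amacc) => // j Hj.
  apply: (Rle_trans _ _ _ (iter_minus_id_approx Hip A Alin Amacc (step k) Hk j (A x) y Dy)).
  have : INR j * step k <= t.
    have Hj' := le_INR j n Hj.
    have := Rmult_le_compat_r _ _ _ (Rlt_le _ _ Hk) Hj'; lra.
  nra.
have -> : S t x ⊖ x ⊕ t ⊙ A x = (U k t x ⊖ x ⊕ (INR n * step k) ⊙ A x) ⊖ (U k t x ⊖ S t x)
  ⊕ (t - INR n * step k) ⊙ A x by vec.
apply: (Rle_trans _ _ _ (norm_triangle _ _)).
have := norm_triangle (U k t x ⊖ x ⊕ (INR n * step k) ⊙ A x) (opp (U k t x ⊖ S t x)).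
rewrite norm_opp norm_scal_R Rabs_pos_eq; last lra.
have E1 : eps / 2 / (norm (A x) + 1) * (norm (A x) + 1) = eps / 2 by field; lra.
have E2 : (t - INR n * step k) * norm (A x) <= eps / 2 by nra.
have E3 : INR n * step k * (t * norm (A y) + 2 * norm (A x ⊖ y)) <=
   t * (t * norm (A y) + 2 * norm (A x ⊖ y)).
  apply: Rmult_le_compat_r => //; nra.
rewrite -/(minus _ (U k t x ⊖ S t x)); lra.
Qed.

Lemma semigroup_derive_dom (x : E) : dom A x ->
  filterlim (fun h : R => (/ h) ⊙ (S h x ⊖ x)) (at_right 0) (locally (opp (A x))).
Proof.
move=> Dx; apply/at_right_iff => eps He.
case: (m_accretive_dense Hip A Alin Amacc (A x) (eps / 4)) => [|y [Dy Hy]]; first lra.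
have N := norm_ge_0 (A y).
have Hq : 0 < eps / 4 / (norm (A y) + 1) by apply: Rdiv_lt_0_compat; lra.
exists (eps / 4 / (norm (A y) + 1)); split => // h [Hh Hh'].
have -> : (/ h) ⊙ (S h x ⊖ x) ⊖ opp (A x) = (/ h) ⊙ (S h x ⊖ x ⊕ h ⊙ A x) by vec.
rewrite norm_scal_R Rabs_pos_eq; last by apply: Rlt_le; apply: Rinv_0_lt_compat.
apply: (Rmult_lt_reg_l h) => //; rewrite -Rmult_assoc Rinv_r ?Rmult_1_l; last lra.
apply: (Rle_lt_trans _ _ _ (semigroup_first_order x y h (Rlt_le _ _ Hh) Dx Dy)).
apply: Rmult_lt_compat_l => //; rewrite (norm_minus_swap (A x)).
have E1 : eps / 4 / (norm (A y) + 1) * (norm (A y) + 1) = eps / 4 by field; lra.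
nra.
Qed.

(** The generator extends [-A], and minus the generator is accretive since the
    semigroup contracts; as [1 + A] is onto, [-A] has no proper extension of
    that kind. *)
Lemma semigroup_generator : generated_by_opp S A.
Proof.
move=> x y; split; last by move=> [Dx ->]; apply: semigroup_derive_dom.
move=> Hy.
case: (proj2 Amacc (x ⊖ y)) => z [Dz Hz].
have Hw : filterlim (fun h : R => (/ h) ⊙ (S h (x ⊖ z) ⊖ (x ⊖ z))) (at_right 0)
    (locally (x ⊖ z)).
  have := semigroup_derive_dom z Dz => Hz'.
  apply/at_right_iff => eps He.
  have He2 : 0 < eps / 2 by lra.
  case: (proj1 (at_right_iff _ _) Hy _ He2) => d1 [Hd1 H1].
  case: (proj1 (at_right_iff _ _) Hz' _ He2) => d2 [Hd2 H2].
  exists (Rmin d1 d2); split; first exact: Rmin_glb_lt.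
  move=> h [Hh Hh'].
  have := H1 h (conj Hh (Rlt_le_trans _ _ _ Hh' (Rmin_l _ _))).
  have := H2 h (conj Hh (Rlt_le_trans _ _ _ Hh' (Rmin_r _ _))).
  have -> : (/ h) ⊙ (S h (x ⊖ z) ⊖ (x ⊖ z)) ⊖ (x ⊖ z) =
    ((/ h) ⊙ (S h x ⊖ x) ⊖ y) ⊖ ((/ h) ⊙ (S h z ⊖ z) ⊖ opp (A z)).
    rewrite semigroup_minus_r.
    have -> : y = x ⊖ z ⊖ A z.
      have -> : y = x ⊖ (x ⊖ y) by vec.
      rewrite -Hz; vec.
    vec.
  move=> P1 P2; apply: (Rle_lt_trans _ _ _ (norm_triangle _ _)); rewrite norm_opp.
  apply: (Rlt_le_trans _ (eps / 2 + eps / 2)); last lra.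
  exact: (Rplus_lt_compat _ _ _ _ P2 P1).
move: Hw; set w := x ⊖ z => Hw.
have w0 : norm w = 0.
  case: (Req_dec (norm w) 0) => // Hn.
  have Hp : 0 < norm w by have := norm_ge_0 w; lra.
  case: (proj1 (at_right_iff _ _) Hw _ Hp) => d [Hd H].
  have := H (d / 2) ltac:(lra).
  set v := (/ (d / 2)) ⊙ (S (d / 2) w ⊖ w) => Hv.
  have C1 := Cauchy_Schwarz Hip (w ⊖ v) w.
  have C2 := Cauchy_Schwarz Hip (S (d / 2) w) w.
  have C3 := semigroup_norm_le (d / 2) w.
  have C4 : ip v w <= 0.
    rewrite /v (ip_scal_l Hip) (ip_minus_l Hip) (inner_norm _ Hip).
    have : 0 < / (d / 2) by apply: Rinv_0_lt_compat; lra.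
    have : norm (S (d / 2) w) * norm w <= norm w * norm w by apply: Rmult_le_compat_r => //; exact: norm_ge_0.
    nra.
  rewrite (ip_minus_l Hip) (inner_norm _ Hip) norm_minus_swap in C1.
  nra.
have Ex : x = z.
  apply: eq_of_norm_minus_le => eps He; rewrite -/w w0; lra.
rewrite Ex; split => //.
have -> : y = x ⊖ (x ⊖ y) by vec.
rewrite -Hz Ex; vec.
Qed.

Lemma is_linear_semigroup (t : R) : is_linear (S t).
Proof.
split.
- exact: semigroup_plus_r.
- exact: semigroup_scal_r.
- exists 1; split; first exact: Rlt_0_1.
  move=> x; rewrite Rmult_1_l; exact: semigroup_norm_le.
Qed.

Theorem semigroup_contraction : contraction_semigroup S.
Proof.
split.
- move=> t _; exact: is_linear_semigroup.
- move=> x; apply: semigroup_neg; exact: Rle_refl.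
- move=> s t x; exact: semigroup_add.
- move=> t x _; exact: semigroup_norm_le.
- move=> x; apply/continuous_on_iff => t _ eps He.
  case: (proj1 (continuous_iff _ _) (semigroup_continuous x t) eps He) => d [Hd H].
  exists d; split => // y _; exact: H.
Qed.

End Generation.

(** * Integrals of continuous functions *)

Section Integrals.
Context {E : CompleteNormedModule R_AbsRing}.

Lemma is_RInt_RInt (f : R -> E) (a b : R) :
  (forall t, continuous f t) -> is_RInt f a b (RInt f a b).
Proof. by move=> Cf; apply: RInt_correct; apply: ex_RInt_continuous => z _. Qed.

Lemma is_RInt_unique_eq (f : R -> E) (a b : R) (l m : E) :
  is_RInt f a b l -> is_RInt f a b m -> l = m.
Proof. by move=> /is_RInt_unique <- /is_RInt_unique. Qed.

Lemma is_RInt_ext_nonneg (f g : R -> E) (t : R) (l : E) : 0 <= t ->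
  (forall s, 0 <= s -> f s = g s) -> is_RInt f 0 t l -> is_RInt g 0 t l.
Proof.
move=> Ht Hfg; apply: is_RInt_ext => s; rewrite Rmin_left // => Hs; apply: Hfg; lra.
Qed.

Lemma norm_is_RInt_le (f : R -> E) (a b M : R) (l : E) :
  (forall s, Rmin a b <= s <= Rmax a b -> norm (f s) <= M) ->
  is_RInt f a b l -> norm l <= Rabs (b - a) * M.
Proof.
case: (Rle_dec a b) => Hab.
- rewrite Rmin_left // Rmax_right // Rabs_pos_eq; last lra.
  by move=> HM; apply: norm_RInt_le_const.
- have Hba : b <= a by lra.
  rewrite Rmin_right // Rmax_left // => HM /is_RInt_swap H.
  rewrite Rabs_minus_sym Rabs_pos_eq; last lra.
  rewrite -(norm_opp l); exact: (norm_RInt_le_const f b a).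
Qed.

Lemma is_RInt_linear (Phi : E -> E) (f : R -> E) (a b : R) (l : E) :
  is_linear Phi -> is_RInt f a b l -> is_RInt (fun s => Phi (f s)) a b (Phi l).
Proof.
move=> LP Hf.
have Hsum ptd : Riemann_sum (fun s => Phi (f s)) ptd = Phi (Riemann_sum f ptd).
  apply: (SF_cons_ind (fun s => Riemann_sum (fun s => Phi (f s)) s = Phi (Riemann_sum f s)))
    => [x0 | h s IH].
  - rewrite /Riemann_sum /=; symmetry; exact: (linear_zero Phi LP).
  - rewrite !Riemann_sum_cons IH (linear_plus _ LP); congr plus.
    by rewrite (linear_scal _ LP).
have HPhi : filterlim Phi (locally l) (locally (Phi l)) by apply: linear_cont.
have := filterlim_comp _ _ _ _ _ _ _ _ Hf HPhi.
apply: filterlim_ext => ptd; rewrite Hsum; exact: (linear_scal _ LP).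
Qed.

(** Only times in [D] are compared, but [f] is continuous on the whole line so
    that its integral exists on both sides of [t]. *)
Lemma is_derive_within_RInt (D : R -> Prop) (f : R -> E) (t : R) : D t ->
  (forall s, continuous f s) ->
  is_derive_within D (fun s => RInt f 0 s) t (f t).
Proof.
move=> Dt Cf; apply/(is_derive_within_iff _ _ _ _ Dt) => eps He.
case: (proj1 (continuous_iff _ _) (Cf t) eps He) => d [Hd H].
exists d; split => // y _ Hy; rewrite Rmult_comm.
apply: (norm_is_RInt_le (fun s => f s ⊖ f t) t y).
- move=> s Hs; apply: Rlt_le; apply: H.
  move: Hs Hy; rewrite /Rmin /Rmax; case: Rle_dec => _; split_Rabs; lra.
- apply: is_RInt_minus; last exact: is_RInt_const.
  have H1 := is_RInt_Chasles _ _ _ _ _ _ (is_RInt_swap _ _ _ _ (is_RInt_RInt f 0 t Cf))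
    (is_RInt_RInt f 0 y Cf).
  by rewrite /minus plus_comm.
Qed.

End Integrals.

Section Derivatives.
Context {E : NormedModule R_AbsRing}.

Lemma is_derive_within_subset (D D' : R -> Prop) (f : R -> E) (t : R) (l : E) :
  D t -> D' t -> (forall s, D' s -> D s) ->
  is_derive_within D f t l -> is_derive_within D' f t l.
Proof.
move=> Dt Dt' HD /(is_derive_within_iff _ _ _ _ Dt) H.
apply/(is_derive_within_iff _ _ _ _ Dt') => eps He.
case: (H eps He) => d [Hd H1]; exists d; split => // y Dy; apply: H1; exact: HD.
Qed.

Lemma is_derive_within_ext (D : R -> Prop) (f g : R -> E) (t : R) (l : E) : D t ->
  (forall s, D s -> f s = g s) -> is_derive_within D f t l -> is_derive_within D g t l.
Proof.
move=> Dt Hfg /(is_derive_within_iff _ _ _ _ Dt) H.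
apply/(is_derive_within_iff _ _ _ _ Dt) => eps He.
case: (H eps He) => d [Hd H1]; exists d; split => // y Dy.
rewrite -(Hfg y) // -(Hfg t) //; exact: H1.
Qed.

Lemma continuous_on_of_continuous (D : R -> Prop) (f : R -> E) :
  (forall t, continuous f t) -> continuous_on D f.
Proof.
move=> H; apply/continuous_on_iff => t _ eps He.
case: (proj1 (continuous_iff _ _) (H t) eps He) => d [Hd H1].
exists d; split => // y _; exact: H1.
Qed.

Context {ip : E -> E -> R}.
Hypothesis Hip : is_inner_product ip.

Lemma is_derive_within_continuous_on (D : R -> Prop) (f f' : R -> E) :
  (forall t, D t -> is_derive_within D f t (f' t)) -> continuous_on D f.
Proof.
move=> H; apply/continuous_on_iff => t Dt eps He.
case: (proj1 (is_derive_within_iff _ _ _ _ Dt) (H t Dt) 1 Rlt_0_1) => d [Hd H1].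
have N := norm_ge_0 (f' t).
have Hq : 0 < eps / (norm (f' t) + 1) by apply: Rdiv_lt_0_compat; lra.
exists (Rmin d (eps / (norm (f' t) + 1))); split; first exact: Rmin_glb_lt.
move=> y Dy Hy.
have := H1 y Dy (Rlt_le_trans _ _ _ Hy (Rmin_l _ _)).
have Hy2 := Rlt_le_trans _ _ _ Hy (Rmin_r _ _).
set r := f y ⊖ f t ⊖ _ => Hr.
have -> : f y ⊖ f t = r ⊕ (y - t) ⊙ f' t.
  by rewrite /r; vec_with Hip.
apply: (Rle_lt_trans _ _ _ (norm_triangle _ _)); rewrite norm_scal_R.
have E1 : eps / (norm (f' t) + 1) * (norm (f' t) + 1) = eps by field; lra.
have := Rabs_pos (y - t); nra.
Qed.

Lemma continuous_on_minus (D : R -> Prop) (f g : R -> E) :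
  continuous_on D f -> continuous_on D g -> continuous_on D (fun s => f s ⊖ g s).
Proof.
move=> /continuous_on_iff Cf /continuous_on_iff Cg.
apply/continuous_on_iff => t Dt eps He.
have He2 : 0 < eps / 2 by lra.
case: (Cf t Dt _ He2) => d1 [Hd1 H1]; case: (Cg t Dt _ He2) => d2 [Hd2 H2].
exists (Rmin d1 d2); split; first exact: Rmin_glb_lt.
move=> y Dy Hy.
have := H1 y Dy (Rlt_le_trans _ _ _ Hy (Rmin_l _ _)).
have := H2 y Dy (Rlt_le_trans _ _ _ Hy (Rmin_r _ _)).
have -> : f y ⊖ g y ⊖ (f t ⊖ g t) = (f y ⊖ f t) ⊖ (g y ⊖ g t) by vec_with Hip.
move=> P1 P2; apply: (Rle_lt_trans _ _ _ (norm_triangle _ _)); rewrite norm_opp; lra.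
Qed.

Lemma is_derive_within_minus (D : R -> Prop) (f g : R -> E) (t : R) (l m : E) : D t ->
  is_derive_within D f t l -> is_derive_within D g t m ->
  is_derive_within D (fun s => f s ⊖ g s) t (l ⊖ m).
Proof.
move=> Dt /(is_derive_within_iff _ _ _ _ Dt) Hf /(is_derive_within_iff _ _ _ _ Dt) Hg.
apply/(is_derive_within_iff _ _ _ _ Dt) => eps He.
have He2 : 0 < eps / 2 by lra.
case: (Hf _ He2) => d1 [Hd1 H1]; case: (Hg _ He2) => d2 [Hd2 H2].
exists (Rmin d1 d2); split; first exact: Rmin_glb_lt.
move=> y Dy Hy.
have := H1 y Dy (Rlt_le_trans _ _ _ Hy (Rmin_l _ _)).
have := H2 y Dy (Rlt_le_trans _ _ _ Hy (Rmin_r _ _)).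
have -> : f y ⊖ g y ⊖ (f t ⊖ g t) ⊖ (y - t) ⊙ (l ⊖ m) =
  (f y ⊖ f t ⊖ (y - t) ⊙ l) ⊖ (g y ⊖ g t ⊖ (y - t) ⊙ m) by vec_with Hip.
move=> P1 P2; apply: (Rle_trans _ _ _ (norm_triangle _ _)); rewrite norm_opp; lra.
Qed.

Lemma is_derive_within_plus_const (D : R -> Prop) (f : R -> E) (t : R) (l c : E) : D t ->
  is_derive_within D f t l -> is_derive_within D (fun s => c ⊕ f s) t l.
Proof.
move=> Dt /(is_derive_within_iff _ _ _ _ Dt) Hf.
apply/(is_derive_within_iff _ _ _ _ Dt) => eps He.
case: (Hf _ He) => d [Hd H]; exists d; split => // y Dy Hy.
have -> : c ⊕ f y ⊖ (c ⊕ f t) = f y ⊖ f t by vec_with Hip.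
exact: H.
Qed.

End Derivatives.

Section FundamentalTheorem.
Context {E : CompleteNormedModule R_AbsRing} {ip : E -> E -> R}.
Hypothesis Hip : is_inner_product ip.

(** The difference of [f] and the integral of [f'] has a vanishing derivative,
    so the energy estimate makes it constant. *)
Lemma is_RInt_derive_within (f f' : R -> E) :
  (forall t, 0 <= t -> is_derive_within nonneg_time f t (f' t)) ->
  continuous_on nonneg_time f' ->
  forall t, 0 <= t -> is_RInt (fun s => f' (Rmax 0 s)) 0 t (f t ⊖ f 0).
Proof.
move=> Hf Cf' t Ht.
set F := fun s => f' (Rmax 0 s).
have CF : forall s, continuous F s by apply: continuous_Rmax_0.
set u := fun s => f s ⊖ RInt F 0 s.
have Du s : 0 <= s -> is_derive_within nonneg_time u s (zero : E).
  move=> Hs; have -> : (zero : E) = f' s ⊖ F s.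
    rewrite /F Rmax_right //; vec_with Hip.
  apply: (is_derive_within_minus Hip) => //; [exact: Hf | exact: is_derive_within_RInt].
have u0 : u 0 = f 0 by rewrite /u RInt_point; vec_with Hip.
set w := fun s => opp (f 0) ⊕ u s.
have Dw s : 0 <= s -> is_derive_within nonneg_time w s (zero : E).
  by move=> Hs; apply: (is_derive_within_plus_const Hip) => //; apply: Du.
have Hw : norm (w t) <= norm (w 0).
  apply: (dissipative_norm_nonincr Hip) => //; last exact: Rle_refl.
  - exact: (is_derive_within_continuous_on Hip _ _ (fun _ => zero : E)).
  - move=> s Hs; exists zero; split; last by rewrite (ip_zero_l Hip); exact: Rle_refl.
    apply: (is_derive_within_subset nonneg_time).
    + exact: Rlt_le.
    + exact: Hs.
    + by move=> r; apply: Rlt_le.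
    + by apply: Dw; apply: Rlt_le.
have Ew0 : w 0 = (zero : E) by rewrite /w u0; vec_with Hip.
have Ewt : w t = (zero : E).
  apply: norm_eq_zero; apply: Rle_antisym; last exact: norm_ge_0.
  by move: Hw; rewrite Ew0 norm_zero.
have -> : f t ⊖ f 0 = RInt F 0 t.
  have -> : RInt F 0 t = f t ⊖ f 0 ⊖ w t by rewrite /w /u; vec_with Hip.
  rewrite Ewt; vec_with Hip.
exact: is_RInt_RInt.
Qed.

End FundamentalTheorem.

(** * Duhamel's formula *)

Definition duhamel {E : CompleteNormedModule R_AbsRing} (A : operator E)
  (g : R -> E) (x : E) (t : R) : E :=
  semigroup A t x ⊕ RInt (fun s => semigroup A (t - s) (g s)) 0 t.

Section Duhamel.
Context {E : CompleteNormedModule R_AbsRing} {ip : E -> E -> R}.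
Hypothesis Hip : is_inner_product ip.
Variable A : operator E.
Hypothesis Alin : linear_operator A.
Hypothesis Amacc : m_accretive ip A.
Variable g : R -> E.
Hypothesis Cg : forall t, continuous g t.

Ltac vec := vec_with Hip.
Local Notation S := (semigroup A).
Local Notation z := (duhamel A g).

(** Near each time [t] both [g] and the semigroup at [g t] vary little; a
    Lebesgue number of this cover of [[- T, T]] serves all times at once. *)
Lemma semigroup_uniform (T eps : R) : 0 < eps ->
  exists d, 0 < d /\ forall s r sigma, Rabs s <= T -> Rabs (s - r) < d -> sigma < d ->
    norm (S sigma (g s) ⊖ g r) <= eps.
Proof.
move=> He; have He3 : 0 < eps / 3 by lra.
have Hloc t : exists d : posreal,
    (forall y, Rabs (y - t) < 2 * d -> norm (g y ⊖ g t) < eps / 3) /\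
    (forall sigma, sigma < d -> norm (S sigma (g t) ⊖ g t) < eps / 3).
  case: (proj1 (continuous_iff _ _) (Cg t) _ He3) => d1 [Hd1 H1].
  case: (proj1 (continuous_iff _ _) (semigroup_continuous Hip A Alin Amacc (g t) 0) _ He3)
    => d2 [Hd2 H2].
  have Hd : 0 < Rmin (d1 / 2) d2 by apply: Rmin_glb_lt => //; lra.
  exists (mkposreal _ Hd); split => [y|sigma] /= Hy.
  - apply: H1; have := Rmin_l (d1 / 2) d2; lra.
  - case: (Rle_lt_dec sigma 0) => Hs.
      by rewrite (semigroup_neg Hip A Alin Amacc) // minus_eq_zero norm_zero.
    have := H2 sigma; rewrite (semigroup_neg Hip A Alin Amacc 0); last exact: Rle_refl.
    apply; rewrite Rminus_0_r Rabs_pos_eq; last lra.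
    have := Rmin_r (d1 / 2) d2; lra.
(* The factor 2 in [Hloc] leaves room for [r], which is close to [s] only. *)
pose delta t := proj1_sig (constructive_indefinite_description _ (Hloc t)).
have Hdelta t := proj2_sig (constructive_indefinite_description _ (Hloc t)).
case: (compactness_value_1d (- T) T delta) => d Hd.
exists d; split; first exact: cond_pos.
move=> s r sigma Hs Hr Hsig.
have HsT : - T <= s <= T by move: Hs; split_Rabs; lra.
apply: NNPP => Hn; apply: (Hd s HsT) => [[t [_ [Ht Hdt]]]]; apply: Hn.
case: (Hdelta t); rewrite -/(delta t) => Hg HS.
have Hp := cond_pos (delta t).
have B1 := Hg s ltac:(lra).
have B2 := Hg r ltac:(move: Hr Ht; split_Rabs; lra).
have B3 := HS sigma ltac:(lra).
have -> : S sigma (g s) ⊖ g r = S sigma (g s ⊖ g t) ⊕ (S sigma (g t) ⊖ g t) ⊖ (g r ⊖ g t).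
  rewrite (semigroup_minus_r Hip A Alin Amacc); vec.
apply: (Rle_trans _ _ _ (norm_triangle _ _)); rewrite norm_opp.
have := norm_triangle (S sigma (g s ⊖ g t)) (S sigma (g t) ⊖ g t).
have := semigroup_norm_le Hip A Alin Amacc sigma (g s ⊖ g t); lra.
Qed.

Lemma duhamel_integrand_continuous (t s : R) : continuous (fun s => S (t - s) (g s)) s.
Proof.
apply/continuous_iff => eps He; have He2 : 0 < eps / 2 by lra.
case: (proj1 (continuous_iff _ _) (Cg s) _ He2) => d1 [Hd1 H1].
case: (proj1 (continuous_iff _ _) (semigroup_continuous Hip A Alin Amacc (g s) (t - s)) _ He2)
  => d2 [Hd2 H2].
exists (Rmin d1 d2); split; first exact: Rmin_glb_lt.
move=> y Hy.
have B1 := H1 y (Rlt_le_trans _ _ _ Hy (Rmin_l _ _)).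
have B2 := H2 (t - y) ltac:(have := Rmin_r d1 d2; move: Hy; split_Rabs; lra).
have -> : S (t - y) (g y) ⊖ S (t - s) (g s) =
  S (t - y) (g y ⊖ g s) ⊕ (S (t - y) (g s) ⊖ S (t - s) (g s)).
  rewrite (semigroup_minus_r Hip A Alin Amacc); vec.
apply: (Rle_lt_trans _ _ _ (norm_triangle _ _)).
have := semigroup_norm_le Hip A Alin Amacc (t - y) (g y ⊖ g s); lra.
Qed.

Lemma is_RInt_duhamel (t a b : R) :
  is_RInt (fun s => S (t - s) (g s)) a b (RInt (fun s => S (t - s) (g s)) a b).
Proof. apply: is_RInt_RInt => s; exact: duhamel_integrand_continuous. Qed.

Lemma duhamel_0 (x : E) : z x 0 = x.
Proof.
rewrite /duhamel RInt_point (semigroup_neg Hip A Alin Amacc); last exact: Rle_refl.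
vec.
Qed.

(** For [0 <= b <= a] the contraction [S b] reduces the difference to the one
    between the times [a - b] and [0]. *)
Lemma semigroup_shift (y : E) (a b d eps : R) :
  (forall sigma, sigma < d -> norm (S sigma y ⊖ y) <= eps) ->
  Rabs (a - b) < d -> norm (S a y ⊖ S b y) <= eps.
Proof.
move=> H.
have K p q : q <= p -> p - q < d -> norm (S p y ⊖ S q y) <= eps.
  move=> Hqp Hd.
  case: (Rle_lt_dec q 0) => Hq.
    rewrite (semigroup_neg Hip A Alin Amacc q) //.
    case: (Rle_lt_dec p 0) => Hp.
      rewrite (semigroup_neg Hip A Alin Amacc p) //.
      have := H (p - q) Hd; rewrite minus_eq_zero norm_zero.
      have := norm_ge_0 (S (p - q) y ⊖ y); lra.
    apply: H; lra.
  have -> : p = q + (p - q) by ring.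
  rewrite (semigroup_add Hip A Alin Amacc); try lra.
  rewrite -(semigroup_minus_r Hip A Alin Amacc).
  apply: (Rle_trans _ _ _ (semigroup_norm_le Hip A Alin Amacc _ _)); exact: H.
case: (Rle_lt_dec b a) => Hab Hd.
  apply: K => //; move: Hd; split_Rabs; lra.
rewrite norm_minus_swap; apply: K; [lra | move: Hd; split_Rabs; lra].
Qed.

Lemma duhamel_continuous (x : E) (t : R) : continuous (z x) t.
Proof.
apply/continuous_iff => eps He.
have He3 : 0 < eps / 3 by lra.
have He3' : 0 < eps / 3 / (Rabs t + 1).
  by apply: Rdiv_lt_0_compat => //; have := Rabs_pos t; lra.
case: (semigroup_uniform (Rabs t) _ He3') => d1 [Hd1 H1].
case: (proj1 (continuous_iff _ _) (semigroup_continuous Hip A Alin Amacc x t) _ He3)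
  => d2 [Hd2 H2].
case: (proj1 (continuous_iff _ _) (Cg t) _ Rlt_0_1) => d3 [Hd3 H3].
set M := norm (g t) + 1.
have HM : 0 < M by have := norm_ge_0 (g t); rewrite /M; lra.
have Hd4 : 0 < eps / 3 / M by apply: Rdiv_lt_0_compat.
set d := Rmin (Rmin d1 d2) (Rmin d3 (eps / 3 / M)).
have Hd : 0 < d by rewrite /d; repeat apply: Rmin_glb_lt.
have [L1 [L2 [L3 L4]]] : d <= d1 /\ d <= d2 /\ d <= d3 /\ d <= eps / 3 / M.
  rewrite /d; have := Rmin_l (Rmin d1 d2) (Rmin d3 (eps / 3 / M)).
  have := Rmin_r (Rmin d1 d2) (Rmin d3 (eps / 3 / M)).
  have := Rmin_l d1 d2; have := Rmin_r d1 d2.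
  have := Rmin_l d3 (eps / 3 / M); have := Rmin_r d3 (eps / 3 / M); lra.
exists d; split => // t' Ht'.
set I := fun a => RInt (fun s => S (a - s) (g s)) 0 a.
set I1 := RInt (fun s => S (t' - s) (g s)) 0 t.
set I2 := RInt (fun s => S (t' - s) (g s)) t t'.
have EI : I t' = I1 ⊕ I2.
  apply: is_RInt_unique; apply: is_RInt_Chasles; exact: is_RInt_duhamel.
have B1 : norm (I1 ⊖ I t) <= Rabs (t - 0) * (eps / 3 / (Rabs t + 1)).
  apply: (norm_is_RInt_le (fun s => S (t' - s) (g s) ⊖ S (t - s) (g s)) 0 t).
  - move=> s Hs; apply: (semigroup_shift _ _ _ d1).
    + move=> sigma Hsig; apply: H1 => //.
      * move: Hs; rewrite /Rmin /Rmax; case: Rle_dec => _; split_Rabs; lra.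
      * by rewrite Rminus_diag Rabs_R0.
    + have -> : t' - s - (t - s) = t' - t by ring.
      lra.
  - apply: is_RInt_minus; exact: is_RInt_duhamel.
have B2 : norm I2 <= Rabs (t' - t) * M.
  apply: (norm_is_RInt_le _ t t'); last exact: is_RInt_duhamel.
  move=> s Hs; apply: (Rle_trans _ _ _ (semigroup_norm_le Hip A Alin Amacc _ _)).
  have := H3 s ltac:(move: Hs Ht'; rewrite /Rmin /Rmax; case: Rle_dec => _; split_Rabs; lra).
  have -> : g s = (g s ⊖ g t) ⊕ g t by vec.
  have -> : (g s ⊖ g t) ⊕ g t ⊖ g t = g s ⊖ g t by vec.
  have := norm_triangle (g s ⊖ g t) (g t); rewrite /M; lra.
have -> : z x t' ⊖ z x t = (S t' x ⊖ S t x) ⊕ (I1 ⊖ I t) ⊕ I2.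
  rewrite /duhamel -/(I t') -/(I t) EI; vec.
apply: (Rle_lt_trans _ _ _ (norm_triangle _ _)).
have := norm_triangle (S t' x ⊖ S t x) (I1 ⊖ I t).
have := H2 t' ltac:(lra).
have E1 : eps / 3 / M * M = eps / 3 by field; lra.
have E2 : eps / 3 / (Rabs t + 1) * (Rabs t + 1) = eps / 3 by field; have := Rabs_pos t; lra.
rewrite Rminus_0_r in B1.
have : Rabs (t' - t) * M <= eps / 3 by have := Rabs_pos (t' - t); nra.
have : Rabs t * (eps / 3 / (Rabs t + 1)) <= eps / 3 by have := Rabs_pos t; nra.
lra.
Qed.

Lemma duhamel_restart (x : E) (t h : R) : 0 <= t -> 0 <= h ->
  is_RInt (fun s => S (t + h - s) (g s)) t (t + h) (z x (t + h) ⊖ S h (z x t)).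
Proof.
move=> Ht Hh.
set f := fun s => S (t + h - s) (g s).
have H1 : is_RInt f 0 t (S h (RInt (fun s => S (t - s) (g s)) 0 t)).
  apply: (is_RInt_ext (fun s => S h (S (t - s) (g s)))).
    move=> s; rewrite Rmin_left // Rmax_right // => Hs.
    rewrite -(semigroup_add Hip A Alin Amacc) //; last lra.
    rewrite /f; congr (S _ _); ring.
  apply: is_RInt_linear; [exact: (is_linear_semigroup Hip A Alin Amacc) | exact: is_RInt_duhamel].
have H2 : is_RInt f 0 (t + h) (RInt f 0 (t + h)) by apply: is_RInt_duhamel.
have := is_RInt_Chasles _ _ _ _ _ _ (is_RInt_swap _ _ _ _ H1) H2.
set l := plus _ _; suff -> : l = z x (t + h) ⊖ S h (z x t) by [].
rewrite /l /duhamel (semigroup_plus_r Hip A Alin Amacc).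
rewrite -(semigroup_add Hip A Alin Amacc) // (Rplus_comm h t) -/f; vec.
Qed.

Lemma duhamel_step (x : E) (T eps : R) : 0 < eps ->
  exists d, 0 < d /\ forall t h, 0 <= t <= T -> 0 <= h < d ->
    norm (z x (t + h) ⊖ S h (z x t) ⊖ h ⊙ g t) <= h * eps.
Proof.
move=> He; case: (semigroup_uniform (T + 1) eps He) => d [Hd H].
exists (Rmin d 1); split; first by apply: Rmin_glb_lt => //; lra.
move=> t h Ht Hh.
have [L1 L2] : h < d /\ h < 1 by have := Rmin_l d 1; have := Rmin_r d 1; lra.
have Eh : t + h - t = h by ring.
have -> : h * eps = Rabs (t + h - t) * eps by rewrite Eh Rabs_pos_eq; lra.
apply: (norm_is_RInt_le (fun s => S (t + h - s) (g s) ⊖ g t) t (t + h)).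
- move=> s; rewrite Rmin_left ?Rmax_right; try lra; move=> Hs.
  apply: H; [rewrite Rabs_pos_eq; lra | rewrite Rabs_pos_eq; lra | lra].
- apply: is_RInt_minus; first by apply: duhamel_restart; lra.
  have := is_RInt_const t (t + h) (g t); by rewrite Eh.
Qed.

(** With [u] the integral of Duhamel's formula over [0, t], the difference
    quotients of the semigroup at [u] are computed from the flow property up to
    a uniform error; their limit identifies [A u] through the generator. *)
Theorem duhamel_mild (x : E) (t : R) : 0 <= t ->
  dom A (RInt (z x) 0 t) /\ z x t ⊕ A (RInt (z x) 0 t) = x ⊕ RInt g 0 t.
Proof.
move=> Ht.
set u := RInt (z x) 0 t; set IG := RInt g 0 t.
have Cz := duhamel_continuous x.
suff Hlim : filterlim (fun h : R => (/ h) ⊙ (S h u ⊖ u)) (at_right 0)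
    (locally (z x t ⊖ x ⊖ IG)).
  case: (proj1 (semigroup_generator Hip A Alin Amacc _ _) Hlim) => Du Hu.
  split => //.
  have -> : A u = opp (z x t ⊖ x ⊖ IG) by rewrite Hu; vec.
  vec.
apply/at_right_iff => eps He.
have He3 : 0 < eps / 4 by lra.
have HeT : 0 < eps / 4 / (t + 1) by apply: Rdiv_lt_0_compat; lra.
case: (duhamel_step x t _ HeT) => d1 [Hd1 H1].
case: (proj1 (continuous_iff _ _) (Cz t) _ He3) => d2 [Hd2 H2].
case: (proj1 (continuous_iff _ _) (Cz 0) _ He3) => d3 [Hd3 H3].
set d := Rmin d1 (Rmin d2 d3).
have Hd : 0 < d by rewrite /d; repeat apply: Rmin_glb_lt.
have [L1 [L2 L3]] : d <= d1 /\ d <= d2 /\ d <= d3.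
  rewrite /d; have := Rmin_l d1 (Rmin d2 d3); have := Rmin_r d1 (Rmin d2 d3).
  have := Rmin_l d2 d3; have := Rmin_r d2 d3; lra.
exists d; split => // h [Hh Hhd].
(* Integrating the flow property over [0, t] gives
   [S h u - u = P - Q - h IG - D] with [D] the integrated error. *)
set P := RInt (z x) t (t + h); set Q := RInt (z x) 0 h.
have HP : norm (P ⊖ h ⊙ z x t) <= h * (eps / 4).
  have Eh : t + h - t = h by ring.
  have -> : h * (eps / 4) = Rabs (t + h - t) * (eps / 4) by rewrite Eh Rabs_pos_eq; lra.
  apply: (norm_is_RInt_le (fun s => z x s ⊖ z x t) t (t + h)).
  - move=> s; rewrite Rmin_left ?Rmax_right; try lra; move=> Hs.
    apply: Rlt_le; apply: H2; rewrite Rabs_pos_eq; lra.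
  - apply: is_RInt_minus; first exact: is_RInt_RInt.
    have := is_RInt_const t (t + h) (z x t); by rewrite Eh.
have HQ : norm (Q ⊖ h ⊙ x) <= h * (eps / 4).
  have Eh : h - 0 = h by ring.
  have -> : h * (eps / 4) = Rabs (h - 0) * (eps / 4) by rewrite Eh Rabs_pos_eq; lra.
  apply: (norm_is_RInt_le (fun s => z x s ⊖ x) 0 h).
  - move=> s; rewrite Rmin_left ?Rmax_right; try lra; move=> Hs.
    have := H3 s; rewrite duhamel_0 Rminus_0_r Rabs_pos_eq; last lra.
    move=> H; apply: Rlt_le; apply: H; lra.
  - apply: is_RInt_minus; first exact: is_RInt_RInt.
    have := is_RInt_const 0 h x; by rewrite Eh.
have Hshift : is_RInt (fun r => z x (r + h)) 0 t (u ⊕ P ⊖ Q).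
  have H : is_RInt (z x) h (t + h) (u ⊕ P ⊖ Q).
    have -> : u ⊕ P ⊖ Q = opp Q ⊕ (u ⊕ P) by vec.
    apply: (is_RInt_Chasles _ _ 0); first by apply: is_RInt_swap; apply: is_RInt_RInt.
    apply: (is_RInt_Chasles _ _ t); exact: is_RInt_RInt.
  have := is_RInt_comp_lin (z x) 1 h 0 t (u ⊕ P ⊖ Q).
  rewrite Rmult_0_r Rmult_1_l Rplus_0_l => /(_ H).
  apply: is_RInt_ext => r _; rewrite (scal_one (_ : E)); by rewrite Rmult_1_l.
set D := (u ⊕ P ⊖ Q) ⊖ S h u ⊖ h ⊙ IG.
have HD : norm D <= t * (h * (eps / 4 / (t + 1))).
  have -> : t * (h * (eps / 4 / (t + 1))) = Rabs (t - 0) * (h * (eps / 4 / (t + 1))).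
    rewrite Rminus_0_r Rabs_pos_eq; lra.
  apply: (norm_is_RInt_le (fun r => z x (r + h) ⊖ S h (z x r) ⊖ h ⊙ g r) 0 t).
  - move=> r; rewrite Rmin_left ?Rmax_right; try lra; move=> Hr.
    apply: H1; lra.
  - apply: is_RInt_minus; first (apply: is_RInt_minus; first exact: Hshift).
    + apply: is_RInt_linear; [exact: (is_linear_semigroup Hip A Alin Amacc) | exact: is_RInt_RInt].
    + apply: is_RInt_scal; exact: is_RInt_RInt.
have HD2 : t * (h * (eps / 4 / (t + 1))) <= h * (eps / 4).
  have E1 : eps / 4 / (t + 1) * (t + 1) = eps / 4 by field; lra.
  nra.
have -> : (/ h) ⊙ (S h u ⊖ u) ⊖ (z x t ⊖ x ⊖ IG) =
  (/ h) ⊙ ((P ⊖ h ⊙ z x t) ⊖ (Q ⊖ h ⊙ x) ⊖ D) by rewrite /D; vec.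
rewrite norm_scal_R Rabs_pos_eq; last by apply: Rlt_le; apply: Rinv_0_lt_compat.
apply: (Rmult_lt_reg_l h) => //; rewrite -Rmult_assoc Rinv_r ?Rmult_1_l; last lra.
apply: (Rle_lt_trans _ _ _ (norm_triangle _ _)); rewrite norm_opp.
have := norm_triangle (P ⊖ h ⊙ z x t) (opp (Q ⊖ h ⊙ x)); rewrite norm_opp.
rewrite -/(minus _ (Q ⊖ h ⊙ x)); nra.
Qed.

End Duhamel.

(** * The Cauchy problem *)

Section CauchyProblem.
Context {E : CompleteNormedModule R_AbsRing} {ip : E -> E -> R}.
Hypothesis Hip : is_inner_product ip.
Variable A : operator E.
Hypothesis Alin : linear_operator A.
Hypothesis Amacc : m_accretive ip A.

Ltac vec := vec_with Hip.
Local Notation S := (semigroup A).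

Lemma is_linear_resolvent (l : R) : 0 < l -> is_linear (resolvent A l).
Proof.
move=> Hl; split.
- by move=> x y; apply: (resolvent_plus Hip A Alin Amacc).
- by move=> k x; apply: (resolvent_scal Hip A Alin Amacc).
- exists 1; split; first exact: Rlt_0_1.
  by move=> x; rewrite Rmult_1_l; apply: (resolvent_norm_le Hip A Alin Amacc).
Qed.

(** Closed operators commute with integrals: [f] is the image of [f + h] under
    the resolvent, which is bounded and passes through the integral. *)
Lemma is_RInt_op (f h : R -> E) (a b : R) (I K : E) :
  (forall s, Rmin a b < s < Rmax a b -> dom A (f s) /\ A (f s) = h s) ->
  is_RInt f a b I -> is_RInt h a b K -> dom A I /\ A I = K.
Proof.
move=> Hf HI HK.
have EI : resolvent A 1 (I ⊕ K) = I.
  apply: (is_RInt_unique_eq f a b) => //.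
  apply: (is_RInt_ext (fun s => resolvent A 1 (f s ⊕ h s))).
    move=> s /Hf [Ds <-]; apply: (resolvent_unique Hip A Alin Amacc) => //; first lra.
    by rewrite (scal_one (_ : E)).
  apply: is_RInt_linear; last exact: is_RInt_plus.
  apply: is_linear_resolvent; lra.
split.
- rewrite -EI; apply: (resolvent_dom Hip A Alin Amacc); lra.
- rewrite -{1}EI (op_resolvent Hip A Alin Amacc) ?EI; [vec | lra].
Qed.

(** The integral [u] of the difference is a classical solution of [u' + A u = 0]
    with [u 0 = 0], so it vanishes, and so does its derivative. *)
Lemma mild_solution_unique (G : R -> E) (W0 : E) (Z1 Z2 : R -> E) :
  mild_solution A G W0 Z1 -> mild_solution A G W0 Z2 ->
  forall t, 0 <= t -> Z1 t = Z2 t.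
Proof.
move=> [C1 H1] [C2 H2].
set w := fun s => Z1 (Rmax 0 s) ⊖ Z2 (Rmax 0 s).
have Cw s : continuous w s.
  apply: continuous_minus; exact: continuous_Rmax_0.
set u := fun t => RInt w 0 t.
have Hu t : 0 <= t -> dom A (u t) /\ A (u t) = opp (w t).
  move=> Ht.
  case: (H1 t Ht) => I1 [K1 [HI1 [HK1 [D1 E1]]]].
  case: (H2 t Ht) => I2 [K2 [HI2 [HK2 [D2 E2]]]].
  have Eu : u t = I1 ⊖ I2.
    apply: is_RInt_unique; apply: (is_RInt_ext (fun s => Z1 s ⊖ Z2 s)).
      move=> s; rewrite Rmin_left ?Rmax_right // => Hs.
      by rewrite /w Rmax_right; [|lra].
    exact: is_RInt_minus.
  have EK : K1 = K2 by apply: (is_RInt_unique_eq G 0 t).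
  rewrite Eu; split; first exact: (dom_minus Hip A Alin).
  rewrite (op_minus Hip A Alin) // /w Rmax_right //.
  have -> : A I1 = W0 ⊕ K1 ⊖ Z1 t by rewrite -E1; vec.
  have -> : A I2 = W0 ⊕ K2 ⊖ Z2 t by rewrite -E2; vec.
  rewrite EK; vec.
have Du (D : R -> Prop) t : D t -> is_derive_within D u t (w t).
  by move=> Dt; apply: is_derive_within_RInt.
have u0 : u 0 = (zero : E) by apply: RInt_point.
have ut t : 0 <= t -> u t = (zero : E).
  move=> Ht; apply: norm_eq_zero; apply: Rle_antisym; last exact: norm_ge_0.
  rewrite -(@norm_zero _ E) -u0.
  apply: (dissipative_norm_nonincr Hip) => //; last exact: Rle_refl.
  - apply: (is_derive_within_continuous_on Hip _ _ w) => s; exact: Du.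
  - move=> s Hs; exists (w s); split; first exact: Du.
    case: (Hu s (Rlt_le _ _ Hs)) => Ds Es.
    have -> : w s = opp (A (u s)) by rewrite Es; vec.
    rewrite (ip_opp_l Hip); have := proj1 Amacc _ Ds; lra.
move=> t Ht.
case: (Hu t Ht) => _; rewrite ut // (op_zero Hip A Alin) /w Rmax_right // => H0.
have -> : Z1 t = Z2 t ⊖ opp (Z1 t ⊖ Z2 t) by vec.
rewrite -H0; vec.
Qed.

(** Integrate the equation and move [A] through the integral. *)
Lemma classical_mild (G U U' : R -> E) :
  continuous_on nonneg_time G -> continuous_on nonneg_time U' ->
  (forall t, 0 <= t -> is_derive_within nonneg_time U t (U' t)) ->
  (forall t, 0 <= t -> dom A (U t) /\ U' t ⊕ A (U t) = G t) ->
  mild_solution A G (U 0) U.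
Proof.
move=> CG CU' HU' HU.
have CU : continuous_on nonneg_time U.
  exact: (is_derive_within_continuous_on Hip _ _ U').
split => // t Ht.
have ext (f : R -> E) I : is_RInt (fun s => f (Rmax 0 s)) 0 t I -> is_RInt f 0 t I.
  by apply: is_RInt_ext_nonneg => // s Hs; rewrite Rmax_right.
have HIU := is_RInt_RInt _ 0 t (continuous_Rmax_0 U CU).
have HIG := is_RInt_RInt _ 0 t (continuous_Rmax_0 G CG).
have HIU' := is_RInt_derive_within Hip U U' HU' CU' t Ht.
case: (is_RInt_op (fun s => U (Rmax 0 s)) (fun s => G (Rmax 0 s) ⊖ U' (Rmax 0 s)) 0 t
  _ _ _ HIU (is_RInt_minus _ _ _ _ _ _ HIG HIU')).
  move=> s _; case: (HU (Rmax 0 s) (Rmax_l _ _)) => Ds Es; split => //.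
  rewrite -Es; vec.
move=> DI EI.
exists (RInt (fun s => U (Rmax 0 s)) 0 t), (RInt (fun s => G (Rmax 0 s)) 0 t).
split; first exact: ext.
split; first exact: ext.
split => //; rewrite EI; vec.
Qed.

Lemma duhamel_mild_solution (G : R -> E) (W0 : E) : continuous_on nonneg_time G ->
  mild_solution A G W0 (duhamel A (fun s => G (Rmax 0 s)) W0).
Proof.
move=> CG; have CG' := continuous_Rmax_0 G CG.
have Cz := duhamel_continuous Hip A Alin Amacc _ CG' W0.
split; first exact: continuous_on_of_continuous.
move=> t Ht.
exists (RInt (duhamel A (fun s => G (Rmax 0 s)) W0) 0 t), (RInt (fun s => G (Rmax 0 s)) 0 t).
split; first exact: is_RInt_RInt.
split; last exact: (duhamel_mild Hip A Alin Amacc).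
apply: (is_RInt_ext_nonneg (fun s => G (Rmax 0 s))) => //; last exact: is_RInt_RInt.
by move=> s Hs; rewrite Rmax_right.
Qed.

(** The derivative of the solution must be the mild solution with source [G']
    and initial value [G 0 - A W0]; integrating the latter gives a classical
    solution, which Duhamel's formula matches by uniqueness. *)
Lemma duhamel_classical (G G' : R -> E) (W0 : E) :
  (forall t, 0 <= t -> is_derive_within nonneg_time G t (G' t)) ->
  continuous_on nonneg_time G' -> dom A W0 ->
  let W := duhamel A (fun s => G (Rmax 0 s)) W0 in
  exists W', continuous_on nonneg_time W' /\ forall t, 0 <= t ->
    dom A (W t) /\ is_derive_within nonneg_time W t (W' t) /\ W' t ⊕ A (W t) = G t.
Proof.
move=> HG CG' D0 W.
have CG : continuous_on nonneg_time G by apply: (is_derive_within_continuous_on Hip _ _ G').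
have CG'' := continuous_Rmax_0 G' CG'.
set z := duhamel A (fun s => G' (Rmax 0 s)) (G 0 ⊖ A W0).
have Cz := duhamel_continuous Hip A Alin Amacc _ CG'' (G 0 ⊖ A W0).
set U := fun t => W0 ⊕ RInt z 0 t.
have U0 : U 0 = W0 by rewrite /U RInt_point; vec.
have HU' t : 0 <= t -> is_derive_within nonneg_time U t (z t).
  move=> Ht; apply: (is_derive_within_plus_const Hip) => //.
  exact: is_derive_within_RInt.
have HU t : 0 <= t -> dom A (U t) /\ z t ⊕ A (U t) = G t.
  move=> Ht.
  case: (duhamel_mild Hip A Alin Amacc _ CG'' (G 0 ⊖ A W0) t Ht); rewrite -/z => DI EI.
  split; first exact: (dom_plus _ Alin).
  rewrite (op_plus _ Alin) //.
  have -> : A (RInt z 0 t) = (G 0 ⊖ A W0) ⊕ RInt (fun s => G' (Rmax 0 s)) 0 t ⊖ z t.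
    rewrite -EI; vec.
  have -> : RInt (fun s => G' (Rmax 0 s)) 0 t = G t ⊖ G 0.
    apply: is_RInt_unique; exact: (is_RInt_derive_within Hip).
  vec.
have Cz' : continuous_on nonneg_time z by apply: continuous_on_of_continuous.
have HUW t : 0 <= t -> U t = W t.
  apply: (mild_solution_unique G W0); last exact: duhamel_mild_solution.
  rewrite -U0; exact: (classical_mild G U z).
exists z; split => // t Ht.
rewrite -HUW //; case: (HU t Ht) => DU EU; split => //; split => //.
by apply: (is_derive_within_ext _ U) => //; apply: HU'.
Qed.

Lemma solves_on_dist_nonincr (G Z1 Z2 : R -> E) :
  continuous_on nonneg_time Z1 -> continuous_on nonneg_time Z2 ->
  solves_on pos_time A G Z1 -> solves_on pos_time A G Z2 ->
  forall t, 0 <= t -> norm (Z1 t ⊖ Z2 t) <= norm (Z1 0 ⊖ Z2 0).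
Proof.
move=> C1 C2 H1 H2 t Ht.
apply: (dissipative_norm_nonincr Hip (fun s => Z1 s ⊖ Z2 s)) => //; last exact: Rle_refl.
- exact: (continuous_on_minus Hip).
- move=> s Hs.
  case: (H1 s Hs) => D1 [l1 [Hl1 E1]]; case: (H2 s Hs) => D2 [l2 [Hl2 E2]].
  exists (l1 ⊖ l2); split; first exact: (is_derive_within_minus Hip).
  have -> : l1 ⊖ l2 = opp (A (Z1 s ⊖ Z2 s)).
    rewrite (op_minus Hip A Alin) //.
    have -> : l1 = G s ⊖ A (Z1 s) by rewrite -E1; vec.
    have -> : l2 = G s ⊖ A (Z2 s) by rewrite -E2; vec.
    vec.
  rewrite (ip_opp_l Hip); have := proj1 Amacc _ (dom_minus Hip A Alin _ _ D1 D2); lra.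
Qed.

(** The Duhamel solution is not differentiable for a general initial value, so it
    is compared with [Z] through classical solutions with nearby initial values
    in the domain. *)
Lemma duhamel_unique_classical (G : R -> E) (W0 : E) (Z : R -> E) :
  C1_on nonneg_time G ->
  continuous_on nonneg_time Z -> Z 0 = W0 -> solves_on pos_time A G Z ->
  forall t, 0 <= t -> Z t = duhamel A (fun s => G (Rmax 0 s)) W0 t.
Proof.
move=> [G' [HG CG']] CZ Z0 HZ t Ht.
have CG : continuous_on nonneg_time G by apply: (is_derive_within_continuous_on Hip _ _ G').
have CG1 := continuous_Rmax_0 G CG.
apply: eq_of_norm_minus_le => eps He.
case: (m_accretive_dense Hip A Alin Amacc W0 (eps / 2)) => [|x [Dx Hx]]; first lra.
set V := duhamel A (fun s => G (Rmax 0 s)) x.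
case: (duhamel_classical G G' x HG CG' Dx) => V' [CV' HV].
have HZV : norm (Z t ⊖ V t) <= norm (Z 0 ⊖ V 0).
  apply: (solves_on_dist_nonincr G) => //.
  - apply: continuous_on_of_continuous; exact: (duhamel_continuous Hip A Alin Amacc).
  - move=> s Hs; have Hs' : 0 <= s := Rlt_le _ _ Hs.
    case: (HV s Hs') => DV [HV' EV]; split => //; exists (V' s); split => //.
    apply: (is_derive_within_subset nonneg_time) => // r; exact: Rlt_le.
have HVW : V t ⊖ duhamel A (fun s => G (Rmax 0 s)) W0 t = S t (x ⊖ W0).
  rewrite /V /duhamel (semigroup_minus_r Hip A Alin Amacc); vec.
have := norm_triangle_minus (Z t) (V t) (duhamel A (fun s => G (Rmax 0 s)) W0 t).
rewrite HVW; have := semigroup_norm_le Hip A Alin Amacc t (x ⊖ W0).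
move: HZV; rewrite Z0 /V (duhamel_0 Hip A Alin Amacc) (norm_minus_swap W0); lra.
Qed.

Theorem m_accretive_Cauchy_problem (G : R -> E) (W0 : E) :
  C1_on nonneg_time G ->
  let W := duhamel A (fun s => G (Rmax 0 s)) W0 in
  W 0 = W0 /\
  mild_solution A G W0 W /\
  (forall Z, mild_solution A G W0 Z -> forall t, 0 <= t -> Z t = W t) /\
  (dom A W0 -> C1_on nonneg_time W /\ solves_on nonneg_time A G W) /\
  (forall Z, continuous_on nonneg_time Z -> Z 0 = W0 -> solves_on pos_time A G Z ->
     forall t, 0 <= t -> Z t = W t) /\
  (forall t, 0 <= t -> is_RInt (fun s => S (t - s) (G s)) 0 t (W t ⊖ S t W0)) /\
  ((forall t, 0 <= t -> G t = zero) ->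
     (forall s t, 0 <= s -> s <= t -> norm (W t) ^ 2 <= norm (W s) ^ 2) /\
     (dom A W0 -> forall t, 0 <= t -> exists d : R,
        is_derive_within nonneg_time (fun s => norm (W s) ^ 2) t d /\ d <= 0)).
Proof.
move=> HG W; have [G' [HG' CG']] := HG.
have CG : continuous_on nonneg_time G by apply: (is_derive_within_continuous_on Hip _ _ G').
have CG1 := continuous_Rmax_0 G CG.
have Hmild : mild_solution A G W0 W by apply: duhamel_mild_solution.
split; first exact: (duhamel_0 Hip A Alin Amacc).
split; first exact: Hmild.
split; first by move=> Z HZ; apply: (mild_solution_unique G W0).
split.
  move=> D0; case: (duhamel_classical G G' W0 HG' CG' D0) => W' [CW' HW]; split.
  - exists W'; split => // t Ht; by case: (HW t Ht) => _ [].
  - move=> t Ht; case: (HW t Ht) => DW [dW EW]; split => //; by exists (W' t).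
split; first by move=> Z; apply: duhamel_unique_classical.
have Hduh t : 0 <= t -> is_RInt (fun s => S (t - s) (G s)) 0 t (W t ⊖ S t W0).
  move=> Ht; apply: (is_RInt_ext_nonneg (fun s => S (t - s) (G (Rmax 0 s)))) => //.
    by move=> s Hs; rewrite Rmax_right.
  have -> : W t ⊖ S t W0 = RInt (fun s => S (t - s) (G (Rmax 0 s))) 0 t.
    rewrite /W /duhamel; vec.
  exact: (is_RInt_duhamel Hip A Alin Amacc).
split; first exact: Hduh.
move=> G0.
have HWS t : 0 <= t -> W t = S t W0.
  move=> Ht.
  have E0 : W t ⊖ S t W0 = (zero : E).
    apply: (is_RInt_unique_eq _ _ _ _ _ (Hduh t Ht)).
    apply: (is_RInt_ext_nonneg (fun _ => zero)) => //.
      move=> s Hs; rewrite G0 //.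
      have -> : (zero : E) = (zero : E) ⊖ (zero : E) by vec.
      rewrite (semigroup_minus_r Hip A Alin Amacc); vec.
    have := is_RInt_const 0 t (zero : E).
    by have -> : scal (t - 0) (zero : E) = (zero : E) by vec.
  have -> : W t = S t W0 ⊕ (W t ⊖ S t W0) by vec.
  rewrite E0; vec.
split.
- move=> s t Hs Hst; apply: pow_incr; split; first exact: norm_ge_0.
  rewrite !HWS //; last lra.
  have -> : t = (t - s) + s by ring.
  rewrite (semigroup_add Hip A Alin Amacc) //; last lra.
  exact: (semigroup_norm_le Hip A Alin Amacc).
- move=> D0 t Ht; case: (duhamel_classical G G' W0 HG' CG' D0) => W' [_ HW].
  case: (HW t Ht) => DW [dW EW]; exists (2 * ip (W' t) (W t)); split.
    exact: (is_derive_within_sqnorm Hip).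
  have -> : W' t = opp (A (W t)).
    have -> : W' t = (W' t ⊕ A (W t)) ⊖ A (W t) by vec.
    rewrite EW G0 //; vec.
  rewrite (ip_opp_l Hip); have := proj1 Amacc _ DW; rewrite /W; lra.
Qed.

End CauchyProblem.

(** * The product space *)

Section ProductComplete.
Variables U V : CompleteNormedModule R_AbsRing.

Let lim_prod (F : (U * V -> Prop) -> Prop) : U * V :=
  (lim (filtermap fst F), lim (filtermap snd F)).

Lemma prod_complete_cauchy (F : (U * V -> Prop) -> Prop) : ProperFilter F ->
  @cauchy (prod_UniformSpace U V) F ->
  forall eps : posreal, F (@ball (prod_UniformSpace U V) (lim_prod F) eps).
Proof.
move=> PF CF eps.
have P1 : ProperFilter (filtermap fst F) by apply: filtermap_proper_filter.
have P2 : ProperFilter (filtermap snd F) by apply: filtermap_proper_filter.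
have C1 : cauchy (filtermap fst F).
  move=> e; case: (CF e) => x Hx; exists (fst x); rewrite /filtermap.
  by apply: filter_imp Hx => y [].
have C2 : cauchy (filtermap snd F).
  move=> e; case: (CF e) => x Hx; exists (snd x); rewrite /filtermap.
  by apply: filter_imp Hx => y [].
exact (filter_and (fun x => ball (lim (filtermap fst F)) eps (fst x))
  (fun x => ball (lim (filtermap snd F)) eps (snd x))
  (complete_cauchy _ P1 C1 eps) (complete_cauchy _ P2 C2 eps)).
Qed.

Lemma prod_close_lim (F1 F2 : (U * V -> Prop) -> Prop) :
  filter_le F1 F2 -> filter_le F2 F1 ->
  @close (prod_UniformSpace U V) (lim_prod F1) (lim_prod F2).
Proof.
move=> H1 H2 eps; split => /=.
- exact (close_lim (filtermap fst F1) (filtermap fst F2)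
    (fun P => H1 (fun x => P (fst x))) (fun P => H2 (fun x => P (fst x))) eps).
- exact (close_lim (filtermap snd F1) (filtermap snd F2)
    (fun P => H1 (fun x => P (snd x))) (fun P => H2 (fun x => P (snd x))) eps).
Qed.

(** Built on the class of the product normed module, so that its underlying
    normed module is convertible with [prod_NormedModule] and results on
    complete spaces apply to the product as it stands. *)
Definition prod_CompleteNormedModule : CompleteNormedModule R_AbsRing :=
  CompleteNormedModule.Pack R_AbsRing (U * V)
    (CompleteNormedModule.Class R_AbsRing (U * V)
      (NormedModule.class R_AbsRing (prod_NormedModule R_AbsRing U V))
      (CompleteSpace.Mixin (prod_UniformSpace U V) lim_prod
        prod_complete_cauchy prod_close_lim))
    (U * V).

End ProductComplete.

Section ProductOperator.
Context {H : CompleteNormedModule R_AbsRing} {inner : H -> H -> R}.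
Hypothesis Hinner : is_inner_product inner.
Local Notation HH := (prod_NormedModule R_AbsRing H H).

Definition prod_inner (x y : HH) : R :=
  inner (fst x) (fst y) + inner (snd x) (snd y).

Lemma prod_inner_is_inner_product : is_inner_product prod_inner.
Proof.
split.
- by move=> x y; rewrite /prod_inner (inner_sym _ Hinner) (inner_sym _ Hinner (snd x)).
- move=> x y w; rewrite /prod_inner.
  change (fst (plus x y)) with (fst x ⊕ fst y); change (snd (plus x y)) with (snd x ⊕ snd y).
  rewrite !(inner_plus_l _ Hinner); ring.
- move=> k x y; rewrite /prod_inner.
  change (fst (scal k x)) with (k ⊙ fst x); change (snd (scal k x)) with (k ⊙ snd x).
  rewrite !(ip_scal_l Hinner); ring.
- move=> x; rewrite /prod_inner !(inner_norm _ Hinner).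
  change (norm x) with (sqrt (norm (fst x) ^ 2 + norm (snd x) ^ 2)).
  rewrite pow2_sqrt //; have := pow2_ge_0 (norm (fst x)); have := pow2_ge_0 (norm (snd x)); lra.
Qed.

Variables (alpha c : R) (L : operator H).
Hypotheses (Halpha : 0 < alpha) (Hc : 0 < c).
Hypotheses (Llin : linear_operator L) (Lmacc : m_accretive inner L).

Ltac vec := vec_with Hinner.

Lemma Btilde_linear : linear_operator (Btilde alpha c L).
Proof.
split.
- exact: (dom_zero _ Llin).
- move=> x y; exact: (dom_plus _ Llin).
- move=> k x; exact: (dom_scal _ Llin).
- move=> [x1 x2] [y1 y2] Dx Dy; apply: injective_projections.
  + change (L (x1 ⊕ y1) ⊕ (alpha * c) ⊙ (x1 ⊕ y1) ⊖ (alpha * sqrt c) ⊙ (x2 ⊕ y2) =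
      (L x1 ⊕ (alpha * c) ⊙ x1 ⊖ (alpha * sqrt c) ⊙ x2) ⊕
      (L y1 ⊕ (alpha * c) ⊙ y1 ⊖ (alpha * sqrt c) ⊙ y2)).
    rewrite (op_plus _ Llin) //; vec.
  + change (opp ((alpha * sqrt c) ⊙ (x1 ⊕ y1)) ⊕ alpha ⊙ (x2 ⊕ y2) =
      (opp ((alpha * sqrt c) ⊙ x1) ⊕ alpha ⊙ x2) ⊕ (opp ((alpha * sqrt c) ⊙ y1) ⊕ alpha ⊙ y2)).
    vec.
- move=> k [x1 x2] Dx; apply: injective_projections.
  + change (L (k ⊙ x1) ⊕ (alpha * c) ⊙ (k ⊙ x1) ⊖ (alpha * sqrt c) ⊙ (k ⊙ x2) =
      k ⊙ (L x1 ⊕ (alpha * c) ⊙ x1 ⊖ (alpha * sqrt c) ⊙ x2)).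
    rewrite (op_scal _ Llin) //; vec.
  + change (opp ((alpha * sqrt c) ⊙ (k ⊙ x1)) ⊕ alpha ⊙ (k ⊙ x2) =
      k ⊙ (opp ((alpha * sqrt c) ⊙ x1) ⊕ alpha ⊙ x2)).
    vec.
Qed.

(** The coupling terms are a complete square:
    [<B (U, V), (U, V)> = <L U, U> + alpha * |sqrt c U - V| ^ 2].  For the range
    condition, [V] is eliminated from the second equation, which leaves a
    resolvent equation for [L] with a positive parameter. *)
Lemma Btilde_m_accretive : m_accretive prod_inner (Btilde alpha c L).
Proof.
have Es : c = sqrt c * sqrt c by rewrite sqrt_sqrt; lra.
split.
- move=> [x1 x2] Dx; rewrite /prod_inner /=.
  have H1 := proj1 Lmacc x1 Dx.
  have H2 : 0 <= inner (sqrt c ⊙ x1 ⊖ x2) (sqrt c ⊙ x1 ⊖ x2).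
    rewrite (inner_norm _ Hinner); exact: pow2_ge_0.
  rewrite !(ip_minus_l Hinner, ip_minus_r Hinner, ip_scal_l Hinner, ip_scal_r Hinner)
    (inner_sym _ Hinner x2 x1) in H2.
  rewrite !(ip_minus_l Hinner, inner_plus_l _ Hinner, ip_scal_l Hinner, ip_opp_l Hinner).
  rewrite (inner_sym _ Hinner x2 x1) {1}Es.
  nra.
- move=> [f1 f2].
  (* The coefficient of the first component once the second is eliminated. *)
  set k := 1 + alpha * c / (1 + alpha).
  have Hk : 0 < k.
    have : 0 < alpha * c / (1 + alpha) by apply: Rdiv_lt_0_compat; nra.
    rewrite /k; lra.
  set p := f1 ⊕ (alpha * sqrt c / (1 + alpha)) ⊙ f2.
  have Hik : 0 < / k by apply: Rinv_0_lt_compat.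
  case: (range_all Hinner L Llin Lmacc (/ k) ((/ k) ⊙ p) Hik) => x [Dx Hx].
  have EL : L x = p ⊖ k ⊙ x.
    have -> : p = k ⊙ ((/ k) ⊙ p) by vec.
    rewrite -Hx; vec.
  exists (x, (/ (1 + alpha)) ⊙ (f2 ⊕ (alpha * sqrt c) ⊙ x)); split => //.
  move: EL; rewrite /k /p => EL.
  set y := (/ (1 + alpha)) ⊙ (f2 ⊕ (alpha * sqrt c) ⊙ x).
  apply: injective_projections.
  + change (x ⊕ (L x ⊕ (alpha * c) ⊙ x ⊖ (alpha * sqrt c) ⊙ y) = f1).
    rewrite EL /y; move: (sqrt c) Es => s ->; vec.
  + change (y ⊕ (opp ((alpha * sqrt c) ⊙ x) ⊕ alpha ⊙ y) = f2).
    rewrite /y; vec.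
Qed.

Lemma source_C1 (F : R -> H) : C1_on nonneg_time F -> C1_on nonneg_time (source c F).
Proof.
move=> [F' [HF CF]].
have norm_fst (x : H) : norm ((x, zero) : HH) = norm x.
  change (sqrt (norm x ^ 2 + norm (zero : H) ^ 2) = norm x).
  rewrite norm_zero /= Rmult_0_l Rplus_0_r Rmult_1_r sqrt_square //; exact: norm_ge_0.
have Hs : 0 < sqrt c by apply: sqrt_lt_R0.
exists (fun t => ((sqrt c ⊙ F' t, zero) : HH)); split.
- move=> t Dt; apply/(is_derive_within_iff _ _ _ _ Dt) => eps He.
  have He' : 0 < eps / sqrt c by apply: Rdiv_lt_0_compat.
  case: (proj1 (is_derive_within_iff _ _ _ _ Dt) (HF t Dt) _ He') => d [Hd H1].
  exists d; split => // y Dy Hy.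
  have -> : source c F y ⊖ source c F t ⊖ (y - t) ⊙ ((sqrt c ⊙ F' t, zero) : HH) =
     (sqrt c ⊙ (F y ⊖ F t ⊖ (y - t) ⊙ F' t), zero).
    apply: injective_projections.
    + change (sqrt c ⊙ F y ⊖ sqrt c ⊙ F t ⊖ (y - t) ⊙ (sqrt c ⊙ F' t) =
        sqrt c ⊙ (F y ⊖ F t ⊖ (y - t) ⊙ F' t)); vec.
    + change (zero ⊖ zero ⊖ (y - t) ⊙ zero = (zero : H)); vec.
  rewrite norm_fst norm_scal_R Rabs_pos_eq; last lra.
  have := H1 y Dy Hy => H2.
  apply: (Rle_trans _ (sqrt c * (eps / sqrt c * Rabs (y - t)))).
    apply: Rmult_le_compat_l; [lra | exact: H2].
  apply: Req_le; field; lra.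
- apply/continuous_on_iff => t Dt eps He.
  have He' : 0 < eps / sqrt c by apply: Rdiv_lt_0_compat.
  case: (proj1 (continuous_on_iff _ _) CF t Dt _ He') => d [Hd H1].
  exists d; split => // y Dy Hy.
  have -> : ((sqrt c ⊙ F' y, zero) : HH) ⊖ (sqrt c ⊙ F' t, zero) =
     (sqrt c ⊙ (F' y ⊖ F' t), zero).
    apply: injective_projections.
    + change (sqrt c ⊙ F' y ⊖ sqrt c ⊙ F' t = sqrt c ⊙ (F' y ⊖ F' t)); vec.
    + change (zero ⊖ zero = (zero : H)); vec.
  rewrite norm_fst norm_scal_R Rabs_pos_eq; last lra.
  have H2 := H1 y Dy Hy.
  apply: (Rlt_le_trans _ (sqrt c * (eps / sqrt c))).
    exact: Rmult_lt_compat_l.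
  apply: Req_le; field; lra.
Qed.

End ProductOperator.

Theorem corollary1
  (H : CompleteNormedModule R_AbsRing) (inner : H -> H -> R)
  (Hinner : is_inner_product inner)
  (alpha c : R) (Halpha : 0 < alpha) (Hc : 0 < c)
  (L : operator H) (Llin : linear_operator L) (Lmacc : m_accretive inner L)
  (F : R -> H) (HF : C1_on nonneg_time F)
  (Winit : prod_NormedModule R_AbsRing H H) :
  let B := Btilde alpha c L in
  let G := source c F in
  exists S : R -> prod_NormedModule R_AbsRing H H
               -> prod_NormedModule R_AbsRing H H,
    contraction_semigroup S /\
    generated_by_opp S B /\
  exists W : R -> prod_NormedModule R_AbsRing H H,
    W 0 = Winit /\
    mild_solution B G Winit W /\
    (forall Z, mild_solution B G Winit Z ->
       forall t, 0 <= t -> Z t = W t) /\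
    (dom B Winit -> C1_on nonneg_time W /\ solves_on nonneg_time B G W) /\
    (forall Z, continuous_on nonneg_time Z -> Z 0 = Winit -> solves_on pos_time B G Z ->
       forall t, 0 <= t -> Z t = W t) /\
    (forall t, 0 <= t ->
       is_RInt (fun s => S (t - s) (G s)) 0 t (minus (W t) (S t Winit))) /\
    ((forall t, 0 <= t -> scal (sqrt c) (F t) = zero) ->
       (forall s t, 0 <= s -> s <= t -> norm (W t) ^ 2 <= norm (W s) ^ 2) /\
       (dom B Winit -> forall t, 0 <= t -> exists d : R,
          is_derive_within nonneg_time (fun s => norm (W s) ^ 2) t d /\ d <= 0)).
Proof.
move=> B G.
pose E := prod_CompleteNormedModule H H.
have Hip := prod_inner_is_inner_product Hinner.
have Blin : linear_operator B := Btilde_linear Hinner alpha c L Llin.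
have Bmacc : m_accretive prod_inner B :=
  Btilde_m_accretive Hinner alpha c L Halpha Hc Llin Lmacc.
have HG : C1_on nonneg_time G := source_C1 Hinner c Hc F HF.
exists (@semigroup E B); split; first exact: (@semigroup_contraction E prod_inner Hip B Blin Bmacc).
split; first exact: (@semigroup_generator E prod_inner Hip B Blin Bmacc).
exists (@duhamel E B (fun s => G (Rmax 0 s)) Winit).
case: (@m_accretive_Cauchy_problem E prod_inner Hip B Blin Bmacc G Winit HG)
  => H1 [H2 [H3 [H4 [H5 [H6 H7]]]]].
do 6 (split; first by []).
move=> F0; apply: H7 => t Ht.
by apply: injective_projections; first exact: F0.
Qed.
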